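(* Consider the static team problems $(\mathcal P_N)$, $N\in\mathbb N$. Suppose that the observations $(y^i)_{i\in\mathbb N}$ are i.i.d. conditioned on $\omega_0$, that $\mathbb U$ is compact, and that $c$ is continuous in its second and third arguments for all $\omega_0$. Assume further that the cost function $c$ is bounded. Write $J_N(P)=\int P(d\underline\gamma)\mu^N(d\omega_0,d\underline y)c^N(\underline\gamma,\underline y,\omega_0)$ for $P\in L^N$. Then: (i) There is a sequence $\epsilon_N$ with $\epsilon_N\to0$ as $N\to\infty$ such that for every $N$ $$\inf_{P^N_\pi\in L^N_{\mathrm{PR,SYM}}}J_N(P^N_\pi)\le\inf_{P^N_\pi\in L^N_{\mathrm{CO}}}J_N(P^N_\pi)+\epsilon_N\qquad\text{and}\qquad\inf_{P^N_\pi\in L^N_{\mathrm{PR,SYM}}}J_N(P^N_\pi)\le\inf_{P^N_\pi\in L^N_{\mathrm{D}}}J_N(P^N_\pi)+\epsilon_N.$$ (ii) If $P^*_\pi\in L_{\mathrm{PR,SYM}}$ is a randomized optimal policy of $(\mathcal P_\infty)$, then there exist $\bar\epsilon_N\ge0$ with $\bar\epsilon_N\to0$ as $N\to\infty$ and $$J_N(P^*_{\pi,N})\le\inf_{P^N_\pi\in L^N_{\mathrm{D}}}J_N(P^N_\pi)+\epsilon_N+\bar\epsilon_N,$$ where $P^*_{\pi,N}$ is the restriction (marginal) of $P^*_\pi$ to the first $N$ components.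
   Context: Static team. On a probability space $(\Omega,\mathcal F,\mathbb P)$ there is a random variable $\omega_0$ with values in a Borel space $\Omega_0$, and decision makers (DMs) $i\in\mathbb N$. All DMs have the same action space $\mathbb U\subseteq\mathbb R^n$ and observation space $\mathbb Y\subseteq\mathbb R^m$ (standard Borel). DM $i$ observes a $\mathbb Y$-valued random variable $y^i=h^i(\omega)$, not affected by any action. $\mu^N$ is the joint law of $(\omega_0,y^1,\dots,y^N)$. Absolute continuity (standing). The conditional law of $(y^1,\dots,y^N)$ given $\omega_0$ is absolutely continuous with respect to a product of reference probability measures, for every $N\in\mathbb N\cup\{\infty\}$; with conditionally i.i.d. observations this means: there are a probability measure $Q$ on $\mathbb Y$ and a function $f$ such that for all Borel $B=B^1\times\cdots\times B^N$ the conditional probability of $(y^1,\dots,y^N)\in B$ given $\omega_0$ equals $\prod_{i=1}^N\int_{B^i}f(y^i,\omega_0)Q(dy^i)$. Policies. The set $\Gamma^i$ of (relaxed) policies of DM $i$ is identified with the set of probability measures on $\mathbb U\times\mathbb Y$ of the form $\Pi(du|y)Q(dy)$, $\Pi$ a stochastic kernel from $\mathbb Y$ to $\mathbb U$, with the weak convergence topology; $\gamma^i(du|y)$ denotes the kernel. The $\Gamma^i$ are copies of one space. $L^N=\mathcal P(\prod_{i=1}^N\Gamma^i)$, $L=\mathcal P(\prod_{i\in\mathbb N}\Gamma^i)$ (Borel probability measures). - $L^N_{\mathrm{CO}}$: mixtures $\int_{[0,1]}\prod_{i=1}^NP^i_\pi(\gamma^i\in\cdot|z)\,\eta(dz)$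 with $\eta\in\mathcal P([0,1])$ and kernels $P^i_\pi(\cdot|z)\in\mathcal P(\Gamma^i)$. - $L^N_{\mathrm{PR,SYM}}$: product measures $\prod_{i=1}^N\tilde P_\pi$ with the same $\tilde P_\pi\in\mathcal P(\Gamma^i)$ for all $i$; $L_{\mathrm{PR,SYM}}$ is defined likewise with $i\in\mathbb N$. - $L^N_{\mathrm D}$: Dirac measures, i.e. $P_\pi(\gamma^1\in A_1,\dots,\gamma^N\in A_N)=\prod_{i=1}^N1_{\{\tilde\gamma^i\in A_i\}}$ for some $\tilde\gamma^i\in\Gamma^i$. Cost. $c:\Omega_0\times\mathbb U\times\mathrm{conv}(\mathbb U)\to\mathbb R_+$ is Borel, where $\mathrm{conv}$ is the convex hull, and $$c^N(\underline\gamma,\underline y,\omega_0):=\int\frac1N\sum_{i=1}^Nc\Big(\omega_0,u^i,\frac1N\sum_{p=1}^Nu^p\Big)\prod_{k=1}^N\gamma^k(du^k|y^k).$$ In $(\mathcal P_\infty)$ the expected cost of $P_\pi\in L$ is $\limsup_{N\to\infty}J_N(P_{\pi,N})$, $P_{\pi,N}$ being the marginal of $P_\pi$ on the first $N$ components; a randomized optimal policy attains the infimum of this cost over $L$. *)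

(* Defs.v *)
From HB Require Import structures.
From mathcomp Require Import all_boot all_order all_algebra.
From mathcomp Require Import all_classical all_reals all_analysis.

Set Implicit Arguments.
Unset Strict Implicit.
Unset Printing Implicit Defensive.

Import Order.TTheory GRing.Theory Num.Theory.
Import numFieldNormedType.Exports.

Local Open Scope classical_set_scope.
Local Open Scope ring_scope.

Definition borel_set (T : topologicalType) : set (set T) := <<s @open T >>.

(* Isomorphic, as a measurable space, to a Borel subset of a complete separable
   metric space. *)
Definition borel_space (R : realType) d (T : measurableType d) : Prop :=
  exists (X : completePseudoMetricType R) (h : T -> X),
    [/\ hausdorff_space X,
        exists2 D : set X, countable D & dense D,
        injective h,
        borel_set (range h) &
        forall A : set T,
          measurable A <-> exists2 B, borel_set B & A = h @^-1` B].

(* Nonempty because a [measurableType] is pointed. *)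
Record nonempty_set (T : Type) := NonemptySet {
  ne_set :> set T;
  ne_setP : ne_set !=set0 }.

(* A nonempty subset of a topological space, as a space of its own: subspace
   topology and the Borel sigma-algebra of that topology. *)
Definition points (T : topologicalType) (A : nonempty_set T) : Type :=
  set_type A.

Section points_instances.
Context (T : topologicalType) (A : nonempty_set T).

HB.instance Definition _ := Topological.on (points A).

Let default_point : points A := SigSub (mem_set (svalP (cid (ne_setP A)))).

HB.instance Definition _ := isPointed.Build (points A) default_point.
HB.instance Definition _ := Measurable.copy (points A)
  (g_sigma_algebraType (@open (points A))).

End points_instances.

Section convex_hull.
Context (R : realType) (V : lmodType R).

Definition convex_hull (A : set V) : set V :=
  [set x | exists k (a : 'I_k -> V) (w : 'I_k -> R),
    [/\ forall i, A (a i), forall i, 0 <= w i,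
        \sum_i w i = 1 & x = \sum_i w i *: a i]].

Lemma convex_hull_nonempty (A : nonempty_set V) : convex_hull A !=set0.
Proof.
have [a Aa] := ne_setP A; exists a, 1%N, (fun=> a), (fun=> 1); split => //.
- by rewrite big_ord1.
- by rewrite big_ord1 scale1r.
Qed.

Definition conv_hull (A : nonempty_set V) := NonemptySet (convex_hull_nonempty A).

End convex_hull.

Section average.
Context (R : realType) (n : nat) (U : nonempty_set 'rV[R]_n) (N : nat).
Variable u : N.+1.-tuple (points U).

Lemma average_in_conv :
  (conv_hull U : set _) (N.+1%:R^-1 *: \sum_(p < N.+1) set_val (tnth u p)).
Proof.
exists N.+1, (fun p => set_val (tnth u p)), (fun=> N.+1%:R^-1); split.
- by move=> i; exact: set_valP.
- by move=> i; rewrite invr_ge0 ler0n.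
- by rewrite sumr_const card_ord -[LHS]mulr_natr mulVf// pnatr_eq0.
- by rewrite scaler_sumr.
Qed.

Definition average : points (conv_hull U) := SigSub (mem_set average_in_conv).

End average.

Section kernel_at.
Context d d' (X : measurableType d) (Y : measurableType d') (R : realType).
Variables (k : R.-pker X ~> Y) (x : X).

Definition kernel_at : set Y -> \bar R := k x.

HB.instance Definition _ := Measure.on kernel_at.
HB.instance Definition _ :=
  Measure_isProbability.Build _ _ _ kernel_at (prob_kernel x).

End kernel_at.

Section product_law.
Context d (T : measurableType d) (R : realType).

Local Open Scope ereal_scope.

Definition tuple_cons N (x : T * N.-tuple T) : N.+1.-tuple T :=
  [the N.+1.-tuple T of x.1 :: x.2].

Lemma measurable_tuple_cons N :
  measurable_fun [set: T * N.-tuple T] (@tuple_cons N).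
Proof. exact: measurable_cons. Qed.

HB.instance Definition _ N := isMeasurableFun.Build _ _ _ _ (@tuple_cons N)
  (@measurable_tuple_cons N).

Fixpoint product_law N : ('I_N -> probability T R) -> probability (N.-tuple T) R :=
  match N with
  | 0 => fun=> \d_[tuple]
  | N'.+1 => fun P => distribution
      (P ord0 \x product_law (fun i => P (lift ord0 i))) (@tuple_cons N')
  end.

End product_law.

Section policy.
Context (R : realType) (n m : nat).
Context (U : nonempty_set 'rV[R]_n) (Y : nonempty_set 'rV[R]_m).
Variable Q : probability (points Y) R.

Local Open Scope ereal_scope.

(* P = Pi(du|y) Q(dy), with Pi = k. *)
Definition disintegrates (P : probability (points U * points Y)%type R)
    (k : R.-pker points Y ~> points U) : Prop :=
  forall A, measurable A -> P A = \int[Q]_y k y (ysection A y).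

Record policy := Policy {
  policy_law :> probability (points U * points Y)%type R;
  policy_form : exists k, disintegrates policy_law k }.

(* A kernel gamma(du|y) is determined by gamma only up to a Q-null set of y; this
   is some choice of it. Under [conditional_density] below, the law of the
   observations is absolutely continuous with respect to powers of Q, so that
   the expected cost of a profile does not depend on the choice. *)
Definition policy_kernel (g : policy) : R.-pker points Y ~> points U :=
  sval (cid (policy_form g)).

HB.instance Definition _ := gen_eqMixin policy.
HB.instance Definition _ := gen_choiceMixin policy.

Lemma constant_policy_form :
  exists k, disintegrates (\d_(point : points U) \x^ Q) k.
Proof. by exists (kdirac (measurable_cst point)). Qed.

HB.instance Definition _ := isPointed.Build policy (Policy constant_policy_form).

Record test_function := TestFunction {
  test_fun :> points U * points Y -> R;
  test_continuous : continuous test_fun;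
  test_bounded : exists M : R, forall x, (`|test_fun x| <= M)%R }.

Definition test_integrals (g : policy) : {ptws test_function -> R} :=
  fun h => (\int[g]_x h x)%R.

(* Topology of weak convergence, and its Borel sigma-algebra. *)
HB.instance Definition _ :=
  Topological.copy policy (initial_topology test_integrals).
HB.instance Definition _ := Measurable.copy policy
  (g_sigma_algebraType (@open policy)).

Definition profile (I : Type) : Type := {ptws I -> policy}.

HB.instance Definition _ I := Topological.on (profile I).
HB.instance Definition _ I := isPointed.Build (profile I) (fun=> point).
HB.instance Definition _ I := Measurable.copy (profile I)
  (g_sigma_algebraType (@open (profile I))).

Definition restrict N (g : profile nat) : profile 'I_N := fun i => g i.

Lemma continuous_restrict N : continuous (@restrict N).
Proof.
move=> g; apply/(@cvg_sup _ _ _ _ _ _) => i A.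
have /= -> := @nbhsE (initial_topology (fun f : profile 'I_N => f i)).
case=> B [[C oC <- ?]] /filterS; apply.
apply: (@proj_continuous _ (fun=> policy) (i : nat) g).
by apply: open_nbhs_nbhs.
Qed.

Lemma measurable_restrict N : measurable_fun [set: profile nat] (@restrict N).
Proof.
apply: (measurability (@open (profile 'I_N))) => //.
move=> _ [A oA <-]; rewrite setTI; apply: sub_sigma_algebra.
by apply: open_comp => // g _; exact: continuous_restrict.
Qed.

HB.instance Definition _ N := isMeasurableFun.Build _ _ _ _ (@restrict N)
  (@measurable_restrict N).

Lemma unit_interval_nonempty : (`[0%R, 1%R]%classic : set R) !=set0.
Proof. by exists 0%R; rewrite /= in_itv /= lexx ler01. Qed.

Definition unit_interval : nonempty_set R := NonemptySet unit_interval_nonempty.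

Definition L_CO N : set (probability (profile 'I_N) R) :=
  [set L | exists (eta : probability (points unit_interval) R)
                  (k : 'I_N -> R.-pker points unit_interval ~> policy),
    forall A : 'I_N -> set policy, (forall i, measurable (A i)) ->
      L [set g : profile 'I_N | forall i, A i (g i)] = \int[eta]_z \prod_(i < N) k i z (A i)].

Definition L_PRSYM N : set (probability (profile 'I_N) R) :=
  [set L | exists Pt : probability policy R,
    forall A : 'I_N -> set policy, (forall i, measurable (A i)) ->
      L [set g : profile 'I_N | forall i, A i (g i)] = \prod_(i < N) Pt (A i)].

(* The infinite product measure, given by its values on cylinders. *)
Definition L_PRSYM_infty : set (probability (profile nat) R) :=
  [set L | exists Pt : probability policy R,
    forall N (A : 'I_N -> set policy), (forall i, measurable (A i)) ->
      L [set g : profile nat | forall i : 'I_N, A i (g i)] = \prod_(i < N) Pt (A i)].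

Definition L_D N : set (probability (profile 'I_N) R) :=
  [set L | exists gt : 'I_N -> policy,
    forall A : 'I_N -> set policy, (forall i, measurable (A i)) ->
      L [set g : profile 'I_N | forall i, A i (g i)] = (\prod_(i < N) \1_(A i) (gt i))%:E].

Definition marginal N (L : probability (profile nat) R) :
    probability (profile 'I_N) R :=
  distribution L (@restrict N).

End policy.

Arguments L_CO {R n m} U {Y} Q N.
Arguments L_PRSYM {R n m} U {Y} Q N.
Arguments L_PRSYM_infty {R n m} U {Y} Q.
Arguments L_D {R n m} U {Y} Q N.

Section team.
Context (R : realType) (dO d0 : measure_display).
Context (Omega : measurableType dO) (Omega0 : measurableType d0).
Context (P : probability Omega R) (w0 : {mfun Omega >-> Omega0}).
Context (n m : nat) (U : nonempty_set 'rV[R]_n) (Y : nonempty_set 'rV[R]_m).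
Variable y : nat -> {mfun Omega >-> points Y}.

Local Open Scope ereal_scope.

(* For every N, the conditional probability of B_1 x ... x B_N given w0 of
   (y_1, ..., y_N) is the product of the q w0 (B_i). *)
Definition product_conditional_law (q : Omega0 -> set (points Y) -> \bar R) :
    Prop :=
  forall N (A : set Omega0) (B : 'I_N -> set (points Y)),
    measurable A -> (forall i, measurable (B i)) ->
    P [set w | A (w0 w) /\ forall i : 'I_N, B i (y i w)] =
      \int[distribution P w0]_(x in A) \prod_(i < N) q x (B i).

Definition conditionally_iid : Prop :=
  exists k : R.-pker Omega0 ~> points Y, product_conditional_law (fun x => k x).

Definition conditional_density (Q : probability (points Y) R)
    (f : points Y -> Omega0 -> R) : Prop :=
  [/\ measurable_fun [set: points Y * Omega0] (fun x => f x.1 x.2),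
      forall z x, (0 <= f z x)%R &
      product_conditional_law (fun x B => \int[Q]_(z in B) (f z x)%:E)].

Definition observation N (w : Omega) : Omega0 * N.-tuple (points Y) :=
  (w0 w, [tuple y i w | i < N]).

Lemma measurable_observation N : measurable_fun [set: Omega] (@observation N).
Proof.
apply/measurable_fun_pair => //=; apply/measurable_fun_tnthP => i.
by apply: (eq_measurable_fun (y i)) => // w _; rewrite /= tnth_mktuple.
Qed.

HB.instance Definition _ N := isMeasurableFun.Build _ _ _ _ (@observation N)
  (@measurable_observation N).

Definition joint_law N : probability (Omega0 * N.-tuple (points Y))%type R :=
  distribution P (@observation N).

Variable Q : probability (points Y) R.
Variable c : Omega0 -> points U -> points (conv_hull U) -> R.

(* Teams have N.+1 decision makers, so that the team size is positive. *)
Definition team_cost N (g : profile U Q 'I_N.+1) (ys : N.+1.-tuple (points Y))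
    (x : Omega0) : \bar R :=
  \int[product_law (fun k => kernel_at (policy_kernel (g k)) (tnth ys k))]_u
    (N.+1%:R^-1 * \sum_(i < N.+1) c x (tnth u i) (average u))%:E.

(* Iterated, because the jointly measurable choice of kernels that a single
   integral over profiles and observations would need is not guaranteed. *)
Definition expected_cost N (L : probability (profile U Q 'I_N.+1) R) : \bar R :=
  \int[L]_g \int[joint_law N.+1]_x team_cost g x.2 x.1.

Definition expected_cost_infty (L : probability (profile U Q nat) R) : \bar R :=
  limn_esup (fun N => expected_cost (marginal N.+1 L)).

Definition optimal_infty (L : probability (profile U Q nat) R) : Prop :=
  expected_cost_infty L = ereal_inf (range expected_cost_infty).

End team.

(* Main.v *)
(* Given omega_0 = x, the actions under a profile (g^1, ..., g^N) are
   independent with laws nu^i_x obtained by mixing g^i over the conditional law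
   of one observation. By the law of large numbers the average action
   concentrates at the mean of the averaged law (nu^1_x + ... + nu^N_x) / N,
   which is the action law of the averaged policy gbar = (g^1 + ... + g^N) / N.
   Since c(x, ., .) is uniformly continuous, the cost of the profile and the
   cost of the constant profile gbar, for teams of any two large sizes, are
   close, uniformly over profiles. Dirac measures at constant profiles belong to
   L_PR,SYM and every measure on profiles costs at least the infimum over
   profiles, which gives (i). Letting one team size go to infinity, the value of
   the infinite problem is at most the value of every large team plus a small
   error, which gives (ii). *)
Require Import Defs.
From HB Require Import structures.
From mathcomp Require Import all_boot all_order all_algebra.
From mathcomp Require Import all_classical all_reals all_analysis.
From mathcomp Require Import measurable_realfun ring lra.

Set Implicit Arguments.
Unset Strict Implicit.
Unset Printing Implicit Defensive.

Import Order.TTheory GRing.Theory Num.Theory.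
Import numFieldNormedType.Exports.

Local Open Scope classical_set_scope.
Local Open Scope ring_scope.

(** * Kernels and product laws *)

(** Two obstacles shape the details. A policy is a law on [points U * points Y], so its kernel is
    known only up to a [Q]-null set, and the kernel of an averaged policy equals the average of the
    kernels only almost everywhere. Observation laws dominated by [Q] for every value of omega_0
    absorb these null sets, so that the averaging identity for action laws holds at every omega_0.
    Moreover the kernels are picked by choice, so the cost is not known to be measurable as a
    function of the profile; measures on profiles are therefore handled through inequalities that
    hold for integrals of arbitrary nonnegative functions. Costs are compared for fixed omega_0,
    with a threshold on the team size that depends on omega_0 but not on the profile. The law of
    large numbers enters in its second-moment form: the coordinates of actions are bounded, so the
    variance of the average action is of order 1/N uniformly over profiles. Uniform continuity in
    the average argument rests on compactness of the convex hull, which comes from Caratheodory's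
    theorem. *)

Section kernel_precomp.
Context d d' d3 (X : measurableType d) (Y : measurableType d')
  (T : measurableType d3) (R : realType).
Variables (k : R.-pker Y ~> T) (g : X -> Y) (mg : measurable_fun [set: X] g).

Definition kernel_precomp of measurable_fun [set: X] g :=
  fun x => k (g x) : {measure set T -> \bar R}.

Local Notation kg := (kernel_precomp mg).

Let measurable_kernel_precomp A :
  measurable A -> measurable_fun [set: X] (kg ^~ A).
Proof.
by move=> mA; exact: (measurableT_comp (measurable_kernel k A mA) mg).
Qed.

HB.instance Definition _ := isKernel.Build _ _ _ _ _ kg
  measurable_kernel_precomp.

Let kernel_precomp_prob x : kg x [set: T] = 1%E.
Proof. exact: prob_kernel. Qed.

HB.instance Definition _ :=
  Kernel_isProbability.Build _ _ _ _ _ kg kernel_precomp_prob.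

End kernel_precomp.

Section kernel_mix.
Context d d' d3 (X : measurableType d) (Y : measurableType d')
  (T : measurableType d3) (R : realType).
Variables (l : R.-pker X ~> Y) (k : R.-pker Y ~> T).

Local Open Scope ereal_scope.

(** [mkcomp] composes with a kernel on [X * Y]; precomposing [k] with the second projection gives
    the ordinary composition of [l] and [k]. *)
Definition kernel_mix : X -> {measure set T -> \bar R} :=
  mkcomp l (kernel_precomp k (@measurable_snd _ _ X Y)).

HB.instance Definition _ := SFiniteKernel.on kernel_mix.

Let kernel_mix_prob x : kernel_mix x [set: T] = 1.
Proof.
rewrite /kernel_mix/= /kcomp (eq_integral (cst 1)).
  by rewrite integral_cst// mul1e prob_kernel.
by move=> y _; rewrite prob_kernel.
Qed.

HB.instance Definition _ :=
  Kernel_isProbability.Build _ _ _ _ _ kernel_mix kernel_mix_prob.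

Lemma kernel_mixE x A : kernel_mix x A = \int[l x]_y k y A.
Proof. by []. Qed.

Lemma integral_kernel_mix x f :
  (forall t, 0 <= f t) -> measurable_fun [set: T] f ->
  \int[kernel_mix x]_t f t = \int[l x]_y \int[k y]_t f t.
Proof. by move=> f0 mf; rewrite [LHS]integral_kcomp. Qed.

End kernel_mix.

Lemma integral_kernel_at d d' (X : measurableType d) (Y : measurableType d')
    (R : realType) (k : R.-pker X ~> Y) x f :
  (\int[kernel_at k x]_y f y = \int[k x]_y f y)%E.
Proof. exact: eq_measure_integral. Qed.

Section product_law_theory.
Context d (T : measurableType d) (R : realType).

Local Open Scope ereal_scope.

Lemma eq_product_law N (P P' : 'I_N -> probability T R) :
  (forall i A, measurable A -> P i A = P' i A) ->
  forall A, measurable A -> product_law P A = product_law P' A.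
Proof.
elim: N => [//|N IH] in P P' * => PP' A mA /=.
have {}mA : measurable (@tuple_cons _ T N @^-1` A).
  by rewrite -[X in measurable X]setTI; exact: measurable_tuple_cons.
rewrite /distribution/= /pushforward /product_measure1/=.
rewrite (eq_measure_integral (P' ord0))/=; last by move=> B mB _; exact: PP'.
apply: eq_integral => x _; apply: IH; first by move=> i B mB; exact: PP'.
exact: measurable_xsection.
Qed.

Lemma eq_integral_product_law N (P P' : 'I_N -> probability T R) f :
  (forall i A, measurable A -> P i A = P' i A) ->
  \int[product_law P]_u f u = \int[product_law P']_u f u.
Proof.
move=> PP'; apply: eq_measure_integral => A mA _; exact: eq_product_law.
Qed.

Lemma integral_product_lawS N (P : 'I_N.+1 -> probability T R) f :
  (forall u, 0 <= f u) -> measurable_fun [set: N.+1.-tuple T] f ->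
  \int[product_law P]_u f u =
  \int[P ord0]_t \int[product_law (fun i => P (lift ord0 i))]_u
    f (tuple_cons (t, u)).
Proof.
move=> f0 mf; rewrite /= ge0_integral_distribution//.
rewrite fubini_tonelli1//.
  apply: (@measurableT_comp _ _ _ _ _ _ f) => //; exact: measurable_tuple_cons.
by move=> x; exact: f0.
Qed.

Lemma measurable_integral_product_law N d' (X : measurableType d')
    (k : 'I_N -> R.-pker X ~> T) (f : X * N.-tuple T -> \bar R) :
  (forall z, 0 <= f z) -> measurable_fun [set: X * N.-tuple T] f ->
  measurable_fun [set: X]
    (fun x => \int[product_law (fun i => kernel_at (k i) x)]_u f (x, u)).
Proof.
elim: N => [|N IH] in d' X k f * => f0 mf.
  rewrite [X in measurable_fun _ X](_ : _ = fun x => f (x, [tuple])).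
    exact: (measurableT_comp mf).
  apply/funext => x; rewrite integral_dirac//= ?diracT ?mul1e//.
  exact: (measurableT_comp mf).
(* The first coordinate joins the parameter: the induction hypothesis is applied over [X * T], which
   is why the parameter space is generalized. *)
pose k' (i : 'I_N) :=
  kernel_precomp (k (lift ord0 i)) (@measurable_fst _ _ X T) : R.-pker _ ~> _.
pose f' (z : (X * T) * N.-tuple T) := f (z.1.1, tuple_cons (z.1.2, z.2)).
pose g z := \int[product_law (fun i => kernel_at (k' i) z)]_u f' (z, u).
have mf' : measurable_fun [set: _] f'.
  apply: (measurableT_comp mf); apply: measurable_fun_pair.
    by apply: measurableT_comp.
  apply: (measurableT_comp (@measurable_tuple_cons _ _ _)).
  by apply: measurable_fun_pair => //; exact: measurableT_comp.
have mg : measurable_fun [set: X * T] g by apply: IH => // z; exact: f0.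
rewrite (_ : (fun x => _) = fun x => \int[k ord0 x]_t g (x, t)).
  apply: (measurable_fun_integral_finite_kernel g (k ord0)) => //.
  by move=> z; apply: integral_ge0 => u _; exact: f0.
apply/funext => x; rewrite integral_product_lawS//; last first.
  exact: (measurableT_comp mf (pair1_measurable x)).
rewrite integral_kernel_at; apply: eq_integral => t _.
exact: eq_integral_product_law.
Qed.

Lemma measurable_integral_product_law_tnth d' d3 (X : measurableType d')
    (Y : measurableType d3) N (k : 'I_N -> R.-pker Y ~> T) (p : X -> N.-tuple Y)
    (f : X * N.-tuple T -> \bar R) :
  measurable_fun [set: X] p ->
  (forall z, 0 <= f z) -> measurable_fun [set: X * N.-tuple T] f ->
  measurable_fun [set: X] (fun x =>
    \int[product_law (fun i => kernel_at (k i) (tnth (p x) i))]_u f (x, u)).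
Proof.
move=> mp f0 mf.
have mt i : measurable_fun [set: X] (fun x => tnth (p x) i).
  exact: (measurableT_comp (measurable_tnth i)).
have := measurable_integral_product_law
  (fun i => kernel_precomp (k i) (mt i)) f0 mf.
by apply: eq_measurable_fun => z _; exact: eq_integral_product_law.
Qed.

End product_law_theory.

Section product_law_mix.
Context d (T : measurableType d) (R : realType).

Local Open Scope ereal_scope.

(** Independent observations followed by independent choices of actions yield independent actions
    with mixed laws. This is the source of the conditional independence of the actions given
    omega_0. *)
Lemma integral_product_law_mix d' d3 (X : measurableType d')
    (Y : measurableType d3) (l : R.-pker X ~> Y) N (k : 'I_N -> R.-pker Y ~> T)
    x (f : N.-tuple T -> \bar R) :
  (forall u, 0 <= f u) -> measurable_fun [set: N.-tuple T] f ->
  \int[product_law (fun=> kernel_at l x)]_y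
    \int[product_law (fun i => kernel_at (k i) (tnth y i))]_u f u =
  \int[product_law (fun i => kernel_at (kernel_mix l (k i)) x)]_u f u.
Proof.
elim: N => [|N IH] in k f * => f0 mf.
  by rewrite integral_dirac//= diracT mul1e.
pose g (y : Y) (z : N.-tuple Y) := \int[k ord0 y]_t
  \int[product_law (fun i => kernel_at (k (lift ord0 i)) (tnth z i))]_u
    f (tuple_cons (t, u)).
have mfc : measurable_fun [set: T * N.-tuple T] (fun x => f (tuple_cons x)).
  by apply: (measurableT_comp mf); exact: measurable_tuple_cons.
pose h t (z : N.-tuple Y) := \int[product_law
   (fun i => kernel_at (k (lift ord0 i)) (tnth z i))]_u f (tuple_cons (t, u)).
have h0 t z : 0 <= h t z by apply: integral_ge0.
have mh : measurable_fun [set: T * N.-tuple Y] (fun z => h z.1 z.2).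
  apply: (measurable_integral_product_law_tnth _ (f :=
    fun z => f (tuple_cons (z.1.1, z.2)))) => //.
  apply: (measurableT_comp mfc); apply: measurable_fun_pair => //.
  exact: measurableT_comp.
have mg : measurable_fun [set: Y * N.-tuple Y] (fun w => g w.1 w.2).
  apply: (measurable_fun_integral_finite_kernel (fun z => h z.2 z.1.2)
    (kernel_precomp (k ord0) (@measurable_fst _ _ Y (N.-tuple Y)))) => //=.
  apply: (@measurableT_comp _ _ _ _ _ _ (fun w => h w.1 w.2) _
    (fun z => (z.2, z.1.2)) mh).
  apply: measurable_fun_pair => //.
  exact: measurableT_comp.
rewrite [RHS]integral_product_lawS// integral_product_lawS//; first last.
- apply: (measurable_integral_product_law_tnth (p := id) _ (f :=
    fun z => f z.2)) => //.
  exact: (measurableT_comp mf).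
- by move=> y; apply: integral_ge0.
rewrite [RHS]integral_kernel_at [RHS]integral_kernel_mix//; first last.
- exact: (@measurable_fun_fubini_tonelli_F _ _ _ _ _ _ (fun w =>
    f (tuple_cons w))).
- by move=> t; apply: integral_ge0.
rewrite integral_kernel_at; apply: eq_integral => y _.
transitivity (\int[product_law (fun=> kernel_at l x)]_z g y z).
  apply: eq_integral => z _; rewrite (integral_product_lawS _ f0 mf).
  rewrite tnth0 integral_kernel_at; apply: eq_integral => t _.
  by apply: eq_integral_product_law => i A mA; rewrite /= tnthS.
(* Tonelli moves the first action outside the remaining observations, so that the induction
   hypothesis applies to the inner integrals. *)
transitivity (\int[kernel_at (k ord0) y]_t
    \int[product_law (fun=> kernel_at l x)]_z h t z).
  by rewrite (@fubini_tonelli _ _ _ _ _ (kernel_at (k ord0) y) _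
    (fun w => h w.1 w.2)).
rewrite integral_kernel_at; apply: eq_integral => t _; rewrite /h IH//.
exact: (measurableT_comp mfc (pair1_measurable t)).
Qed.

End product_law_mix.

(** * Conditional law of the observations *)

Section density_kernel.
Context d d' (X : measurableType d) (Z : measurableType d') (R : realType).
Variables (Q : probability Z R) (f : Z -> X -> R).
Hypothesis mf : measurable_fun [set: Z * X] (fun z => f z.1 z.2).
Hypothesis f0 : forall z x, 0 <= f z x.

Local Open Scope ereal_scope.

Definition density_measure (x : X) (A : set Z) : \bar R :=
  \int[Q]_(z in A) (f z x)%:E.

Let mf1 x : measurable_fun [set: Z] (fun z => (f z x)%:E).
Proof. by apply/measurable_EFinP;
  exact: (measurableT_comp mf (pair2_measurable x)). Qed.

Let density0 x : density_measure x set0 = 0.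
Proof. exact: integral_set0. Qed.

Let density_ge0 x A : 0 <= density_measure x A.
Proof. by apply: integral_ge0 => z _; rewrite lee_fin. Qed.

Let density_sigma_additive x : semi_sigma_additive (density_measure x).
Proof.
move=> A mA tA mUA; rewrite /density_measure.
rewrite ge0_integral_bigcup//; last 2 first.
- exact: measurable_funTS.
- by move=> z _; rewrite lee_fin.
by apply: is_cvg_nneseries => n _ _; exact: density_ge0.
Qed.

HB.instance Definition _ x := isMeasure.Build _ _ _ (density_measure x)
  (density0 x) (density_ge0 x) (@density_sigma_additive x).

Definition density_kernel : X -> {measure set Z -> \bar R} := density_measure.

Let measurable_density_kernel A :
  measurable A -> measurable_fun [set: X] (density_kernel ^~ A).
Proof.
move=> mA; rewrite /density_kernel /= /density_measure.
rewrite [X in measurable_fun _ X](_ : _ =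
  fun x => \int[Q]_z (f z x * \1_A z)%:E).
  apply: (@measurable_fun_fubini_tonelli_G _ _ _ _ _ Q
    (fun z => (f z.1 z.2 * \1_A z.1)%:E)).
    apply/measurable_EFinP; apply: measurable_funM => //.
    by apply: measurableT_comp => //; exact: measurable_indic.
  by move=> z; rewrite lee_fin mulr_ge0.
apply/funext => x; rewrite integral_mkcond; apply: eq_integral => z _.
by rewrite epatch_indic/= EFinM.
Qed.

HB.instance Definition _ :=
  isKernel.Build _ _ _ _ _ density_kernel measurable_density_kernel.

(** Where the total mass is 0 or infinite, normalization returns [Q] itself; elsewhere the measure
    has a density. Domination thus holds at every [x], not just almost every [x]. *)
Lemma density_kernel_dominated x A :
  measurable A -> Q A = 0 -> knormalize density_kernel Q x A = 0.
Proof.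
move=> mA QA0; rewrite /knormalize/= /mnormalize; case: ifPn => // _.
rewrite [X in X * _](_ : _ = 0) ?mul0e//.
by apply: null_set_integral => //; exact: measurable_funTS.
Qed.

Lemma density_kernel_normalized x :
  density_kernel x [set: Z] = 1 ->
  knormalize density_kernel Q x = density_kernel x :> (set Z -> \bar R).
Proof.
move=> f1; apply/funext => A; rewrite /knormalize/= /mnormalize f1.
by rewrite gt_eqF//= invr1 mule1.
Qed.

End density_kernel.

Section graph_kernel.
Context d d' (X : measurableType d) (T : measurableType d') (R : realType).
Variables (k : R.-pker X ~> T) (N : nat).

Local Open Scope ereal_scope.

Definition pair_with (x : X) (u : N.-tuple T) : X * N.-tuple T := (x, u).

HB.instance Definition _ x :=
  isMeasurableFun.Build _ _ _ _ (pair_with x) (pair1_measurable x).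

(** Carrying [x] along with the sample makes the mixture over the law of omega_0 a candidate for the
    joint law of omega_0 and the observations. *)
Definition graph_kernel (x : X) : {measure set (X * N.-tuple T) -> \bar R} :=
  distribution (product_law (fun _ : 'I_N => kernel_at k x)) (pair_with x).

Lemma integral_graph_kernel x f :
  (forall z, 0 <= f z) -> measurable_fun [set: X * N.-tuple T] f ->
  \int[graph_kernel x]_z f z =
  \int[product_law (fun _ : 'I_N => kernel_at k x)]_u f (x, u).
Proof. by move=> f0 mf; rewrite ge0_integral_distribution. Qed.

Let measurable_graph_kernel A :
  measurable A -> measurable_fun [set: X] (graph_kernel ^~ A).
Proof.
move=> mA; have m1 : measurable_fun [set: X * N.-tuple T] (EFin \o \1_A : _ ->
  \bar R).
  by apply/measurable_EFinP; exact: measurable_indic.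
have p1 z : 0 <= (EFin \o \1_A) z :> \bar R by rewrite lee_fin.
have := measurable_integral_product_law (fun _ : 'I_N => k) p1 m1.
by apply: eq_measurable_fun => x _;
  rewrite -integral_graph_kernel// integral_indic// setIT.
Qed.

HB.instance Definition _ :=
  isKernel.Build _ _ _ _ _ graph_kernel measurable_graph_kernel.

Let graph_kernel_prob x : graph_kernel x [set: _] = 1.
Proof. exact: probability_setT. Qed.

HB.instance Definition _ :=
  Kernel_isProbability.Build _ _ _ _ _ graph_kernel graph_kernel_prob.

End graph_kernel.

Lemma measurable_rectangle d (T : measurableType d) N (B : 'I_N -> set T) :
  (forall i, measurable (B i)) ->
  measurable [set u : N.-tuple T | forall i, B i (tnth u i)].
Proof.
move=> mB; rewrite [X in measurable X](_ : _ =
    \bigcap_(i in [set: 'I_N]) (@tnth _ T ^~ i @^-1` B i)); last first.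
  by apply/seteqP; split => [u Bu i _|u Bu i]; exact: Bu.
apply: fin_bigcap_measurable => // i _; rewrite -[X in measurable X]setTI.
exact: measurable_tnth.
Qed.

Lemma product_law_rectangle d (T : measurableType d) (R : realType) N
    (P : 'I_N -> probability T R) (B : 'I_N -> set T) :
  (forall i, measurable (B i)) ->
  product_law P [set u | forall i,
    B i (tnth u i)] = (\prod_(i < N) P i (B i))%E.
Proof.
elim: N => [|N IH] in P B * => mB.
  by rewrite big_ord0 /= diracE mem_set// => -[].
rewrite big_ord_recl -IH// -product_measure1E//; last first.
  exact: (measurable_rectangle (fun i => mB (lift ord0 i))).
rewrite /=/distribution /pushforward; congr product_measure1.
apply/seteqP; split => -[t u]/=.
  move=> Bu; split; first exact: (Bu ord0).
  by move=> i; have := Bu (lift ord0 i); rewrite tnthS.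
move=> [Bt Bu] i; case: (unliftP ord0 i) => [j|] ->; first by rewrite tnthS.
by rewrite tnth0.
Qed.

Lemma graph_kernel_rectangle d d' (X : measurableType d)
    (T : measurableType d') (R : realType) (k : R.-pker X ~> T) N x (A : set X)
    (B : 'I_N -> set T) :
  (forall i, measurable (B i)) ->
  graph_kernel k N x [set z | A z.1 /\ forall i, B i (tnth z.2 i)] =
  ((\1_A x)%:E * \prod_(i < N) k x (B i))%E.
Proof.
move=> mB; rewrite /graph_kernel/= /distribution/= /pushforward indicE.
rewrite -(product_law_rectangle (fun=> kernel_at k x) mB).
have [xA|xA] := boolP (x \in A).
  rewrite mul1e; congr (product_law _ _).
  by apply/seteqP; split => u /= => [[]//|Bu]; split => //; rewrite inE in xA.
rewrite mul0e -(measure0 (product_law (fun _ : 'I_N => kernel_at k x))).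
congr (product_law _ _); apply/seteqP; split => u //= [Ax _].
by rewrite mem_set in xA.
Qed.

(** The identity out of the sigma-algebra generated by rectangles is measurable because each of its
    coordinates is. *)
Lemma measurable_tuple_rectangles d d' (X : measurableType d)
    (T : measurableType d') N (A : set (X * N.-tuple T)) :
  measurable A ->
  <<s [set C | exists D (B : 'I_N -> set T),
    [/\ measurable D, forall i, measurable (B i) &
        C = [set z | D z.1 /\ forall i, B i (tnth z.2 i)]] ]>> A.
Proof.
set G := (X in <<s X >>).
pose idG (z : g_sigma_algebraType G) : X * N.-tuple T := z.
suff: measurable_fun [set: g_sigma_algebraType G] idG.
  by move=> /(_ measurableT A) + mA => /(_ mA); rewrite setTI.
apply/measurable_fun_pairP; split.
  move=> _ D mD; rewrite setTI; apply: sub_sigma_algebra.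
  exists D, (fun=> setT); split => //.
  by apply/seteqP; split => z //= [].
apply/measurable_fun_tnthP => i _ B mB; rewrite setTI; apply: sub_sigma_algebra.
exists setT, (fun j => if j == i then B else setT); split => //.
  by move=> j; case: ifP.
apply/seteqP; split => z /=.
  by move=> Bz; split => // j; case: eqP => [->|].
by move=> [_ /(_ i)]; rewrite eqxx.
Qed.

Section joint_law_theory.
Context (R : realType) (dO d0 : measure_display).
Context (Omega : measurableType dO) (Omega0 : measurableType d0).
Context (P : probability Omega R) (w0 : {mfun Omega >-> Omega0}).
Context (m : nat) (Y : nonempty_set 'rV[R]_m).
Variables (y : nat -> {mfun Omega >-> points Y}) (Q : probability (points Y) R).
Variable f : points Y -> Omega0 -> R.
Hypothesis mf : measurable_fun [set: points Y * Omega0] (fun z => f z.1 z.2).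
Hypothesis f0 : forall z x, 0 <= f z x.
Hypothesis fy : product_conditional_law P w0 y
  (fun x B => \int[Q]_(z in B) (f z x)%:E)%E.

Local Open Scope ereal_scope.

Let P0 : probability Omega0 R := distribution P w0.

(* Normalized so as to be a probability dominated by Q for every x, including
   the null set of x for which f(., x) does not integrate to 1. *)
Definition observation_kernel : R.-pker Omega0 ~> points Y :=
  knormalize (density_kernel Q mf f0) Q.

(** The conditional law of one unconstrained observation says that the total mass, integrated over
    any measurable [A], gives the [P0]-measure of [A]. *)
Lemma density_kernel_ae1 :
  {ae P0, forall x, density_kernel Q mf f0 x [set: points Y] = 1}.
Proof.
have h A : measurable A -> \int[P0]_(x in A) density_kernel Q mf f0 x setT =
  \int[P0]_(x in A) cst 1 x.
  move=> mA; rewrite integral_cst//= mul1e.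
  have := @fy 1%N A (fun=> setT) mA (fun=> measurableT).
  under [in RHS]eq_integral do rewrite big_ord1.
  move=> <-; rewrite /P0 /distribution/= /pushforward; congr (P _).
  by apply/seteqP; split => w //= [].
have : ae_eq P0 setT (cst 1) (fun x => density_kernel Q mf f0 x setT).
  apply: integral_ae_eq => //.
  - exact: finite_measure_integrable_cst.
  - exact: measurable_kernel.
  - by move=> E _ mE; rewrite h.
by move=> []N [mN N0 sN]; exists N; split => // x /= nx;
  apply: sN => /= /(_ I) /esym.
Qed.

Lemma joint_law_rectangle N A (B : 'I_N -> set (points Y)) :
  measurable A -> (forall i, measurable (B i)) ->
  joint_law P w0 y N [set z | A z.1 /\ forall i, B i (tnth z.2 i)] =
  \int[P0]_x graph_kernel observation_kernel N x
    [set z | A z.1 /\ forall i, B i (tnth z.2 i)].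
Proof.
move=> mA mB; have := fy mA mB.
rewrite (_ : [set w | _] = observation w0 y N @^-1`
  [set z | A z.1 /\ forall i, B i (tnth z.2 i)]); last first.
  apply/seteqP; split => w /= [Aw Bw]; split => // i; have := Bw i.
    by rewrite tnth_mktuple.
  by rewrite tnth_mktuple.
move=> fAB; apply: (eq_trans fAB).
under [in RHS]eq_integral do rewrite graph_kernel_rectangle//.
have mprod (k : R.-ker Omega0 ~> points Y) :
    measurable_fun [set: Omega0] (fun x => \prod_(i < N) k x (B i)).
  elim: (index_enum _) => [|i s IH].
    by under eq_fun do rewrite big_nil; exact: measurable_cst.
  under eq_fun do rewrite big_cons.
  by apply: emeasurable_funM => //; exact: measurable_kernel.
have mind : measurable_fun [set: Omega0] (fun x => (\1_A x : R)%:E).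
  by apply/measurable_EFinP; exact: measurable_indic.
rewrite [LHS]integral_mkcond epatch_indic; apply: ge0_ae_eq_integral => //=.
- by apply: emeasurable_funM => //; exact: (mprod (density_kernel Q mf f0)).
- by apply: emeasurable_funM => //; exact: (mprod observation_kernel).
- by move=> x _; rewrite mule_ge0 ?lee_fin// prode_ge0// => i _;
    apply: integral_ge0 => z _; rewrite lee_fin.
- by move=> x _; rewrite mule_ge0 ?lee_fin// prode_ge0.
apply: filterS density_kernel_ae1 => x /= f1 _; rewrite muleC; congr *%E.
by apply: eq_bigr => i _; rewrite /observation_kernel density_kernel_normalized.
Qed.

Lemma integral_joint_law N (h : Omega0 * N.-tuple (points Y) -> \bar R) :
  (forall z, 0 <= h z) -> measurable_fun [set: _] h ->
  \int[joint_law P w0 y N]_z h z =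
  \int[P0]_x \int[product_law (fun _ : 'I_N =>
    kernel_at observation_kernel x)]_u h (x, u).
Proof.
move=> h0 mh.
(* A kernel from [unit] is a single measure; in this form [P0] can be mixed with the graph
   kernel. *)
pose G := kernel_mix
  (@kprobability _ _ unit _ R _ (measurable_cst (P0 : pprobability Omega0 R)))
  (graph_kernel observation_kernel N).
rewrite (eq_measure_integral (G tt)).
  rewrite /G integral_kernel_mix//.
  by apply: eq_integral => x _; rewrite integral_graph_kernel.
move=> A mA _.
move: A {mA} (measurable_tuple_rectangles mA).
(* The rectangles form a pi-system that contains the whole space, so two finite measures agreeing on
   them coincide. *)
apply: (@g_sigma_algebra_measure_unique _ _ _ _ _ (fun=> setT)).
- move=> _ [D [B [mD mB ->]]].
  rewrite [X in measurable X](_ : _ =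
    D `*` [set u | forall i, B i (tnth u i)]); last by apply/seteqP;
      split => -[].
  by apply: measurableX => //; exact: measurable_rectangle.
- move=> _; exists setT, (fun=> setT); split => //.
  by apply/seteqP; split.
- by rewrite bigcup_const.
- move=> _ _ [D [B [mD mB ->]]] [D' [B' [mD' mB' ->]]].
  exists (D `&` D'), (fun i => B i `&` B' i); split => //.
  + exact: measurableI.
  + by move=> i; exact: measurableI.
  + apply/seteqP; split => z /=.
      by move=> [[Dz Bz] [Dz' Bz']]; split => // i; split.
    by move=> [[Dz Dz'] Bz]; split; split => // i; have [] := Bz i.
- move=> _ [D [B [mD mB ->]]].
  exact: (eq_trans (joint_law_rectangle mD mB)).
- by move=> _; apply: (le_lt_trans (probability_le1 _ _)) => //; rewrite ltry.
Qed.

End joint_law_theory.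

(** * Borel sets and convex hulls of row vectors *)

Lemma compact_points (T : topologicalType) (A : nonempty_set T) :
  compact (A : set T) -> compact [set: points A].
Proof.
move=> cA F FF _; pose p (u : points A) := set_val u.
pose G := p @ F.
have GA : G A
  by rewrite /G /fmap/=; apply: filterS filterT => u _; exact: set_valP.
have [x [Ax xG]] := cA G _ GA.
exists (SigSub (mem_set Ax) : points A); split => // E V FE.
rewrite /= (@nbhsE (initial_topology (@set_val T A))) => -[W [[B oB <-] Bx] WV].
have [_ [[e Ee <-] Be]] : (p @` E) `&` B !=set0.
  apply: xG; first by rewrite /G /fmap/=; apply: filterS FE => u Eu; exists u.
  exact: open_nbhs_nbhs.
by exists e; split => //; exact: WV.
Qed.

Section borel_rV.
Context d (T : measurableType d) (R : realType) (n : nat).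

(** An open set is a countable union of cubes with rational centers, and membership in a cube is a
    finite conjunction of conditions on coordinates. *)
Lemma measurable_preimage_open_rV (g : T -> 'rV[R]_n) (O : set 'rV[R]_n) :
  (forall j, measurable_fun [set: T] (fun t => g t ord0 j)) -> open O ->
  measurable (g @^-1` O).
Proof.
move=> mg oO.
pose B (qk : 'rV[rat]_n * nat) : set 'rV[R]_n :=
  [set v | forall j, `|ratr (qk.1 ord0 j) - v ord0 j| < qk.2.+1%:R^-1].
(* Empty unless the cube lies in [O], so that the union can range over all centers and sizes. *)
pose F qk := [set v | B qk v /\ B qk `<=` O].
have -> : O = \bigcup_qk F qk.
  apply/seteqP; split=> [x Ox|x [qk _]]; last first.
    by move=> [Bx]; exact.
  have /nbhs_ballP[e /= e0 xeO] : nbhs x O by apply: open_nbhs_nbhs.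
  have [k ke] : exists k : nat, (k.+1%:R^-1 : R) < e / 2.
    by have [k] := ltr_add_invr (divr_gt0 e0 (ltr0n R 2)); rewrite add0r;
      exists k.
  have q_ex j : exists q : rat, `|ratr q - x ord0 j| < k.+1%:R^-1.
    have [|q] := @rat_in_itvoo R (x ord0 j - k.+1%:R^-1) (x ord0 j +
      k.+1%:R^-1).
      by rewrite ltrD2l gt0_cp// invr_gt0.
    by rewrite in_itv/= -ltr_distl; exists q.
  pose q : 'rV[rat]_n := \row_j sval (cid (q_ex j)).
  exists (q, k) => //; split.
    by move=> j /=; rewrite mxE; exact: (svalP (cid (q_ex j))).
  move=> v Bv; apply: xeO; split => // i j; rewrite (ord1 i).
  have := Bv j; rewrite /= mxE; move: (sval _) (svalP (cid (q_ex j))) =>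
    r xr vr.
  rewrite /ball/= -(subrKA (ratr r)) (splitr e).
  apply: (le_lt_trans (ler_normD _ _)); apply: ltrD; last exact: lt_trans ke.
  by rewrite distrC; exact: lt_trans ke.
rewrite preimage_bigcup; apply: countable_bigcupT_measurable => // qk.
have [BO|nBO] := pselect (B qk `<=` O); last first.
  by rewrite (_ : _ @^-1` _ = set0)//; apply/seteqP; split => // t [].
rewrite (_ : _ @^-1` _ = \bigcap_(j in [set: 'I_n]) [set t | `|ratr (qk.1 ord0
  j) - g t ord0 j| < qk.2.+1%:R^-1]).
  apply: fin_bigcap_measurable => // j _.
  have mh : measurable_fun [set: T] (fun t =>
    `|ratr (qk.1 ord0 j) - g t ord0 j|).
    by apply: measurableT_comp => //; exact: measurable_funB.
  have := mh measurableT `]-oo, qk.2.+1%:R^-1[%classic (measurable_itv _).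
  by rewrite setTI preimage_itvNyo.
by apply/seteqP; split => [t [Bt _] j _|t Bt]; [exact: Bt|split => // j;
  exact: Bt].
Qed.

End borel_rV.

Lemma measurable_to_points d (T : measurableType d) (R : realType) n
    (A : nonempty_set 'rV[R]_n) (g : T -> points A) :
  (forall j, measurable_fun [set: T] (fun t => set_val (g t) ord0 j)) ->
  measurable_fun [set: T] g.
Proof.
move=> mg; apply: (measurability (@open (points A))) => //.
move=> _ [_ [B oB <-] <-]; rewrite setTI.
exact: (measurable_preimage_open_rV mg).
Qed.

Lemma continuous_measurable_points (T : topologicalType) (A : nonempty_set T)
    (R : realType) (g : points A -> R) :
  continuous g -> measurable_fun [set: points A] g.
Proof.
move=> cg; apply: (measurability _ (RGenOpens.measurableE R)) => //.
move=> _ [_ [a [b ->] <-]]; rewrite setTI; apply: sub_sigma_algebra.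
by apply: open_comp => [u _|]; [exact: cg|exact: interval_open].
Qed.

Lemma continuous_coord (R : realType) n (A : nonempty_set 'rV[R]_n) j :
  continuous (fun u : points A => set_val u ord0 j).
Proof.
move=> u; apply: (@continuous_comp _ _ _ (set_val : points A -> 'rV[R]_n)
  (fun v : 'rV[R]_n => v ord0 j)).
  exact: (@initial_continuous _ _ (@set_val _ A)).
exact: coord_continuous.
Qed.

Lemma measurable_coord (R : realType) n (A : nonempty_set 'rV[R]_n) j :
  measurable_fun [set: points A] (fun u => set_val u ord0 j).
Proof. by apply: continuous_measurable_points; exact: continuous_coord. Qed.

Lemma continuous_segment (R : numFieldType) (V : normedModType R) :
  continuous (fun t : R * (V * V) => (1 - t.1) *: t.2.1 + t.1 *: t.2.2).
Proof.
move=> t.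
have c21 : t'.2.1 @[t' --> t] --> t.2.1.
  by apply: (@continuous_comp _ _ _ snd fst); [exact: cvg_snd|exact: cvg_fst].
have c22 : t'.2.2 @[t' --> t] --> t.2.2.
  by apply: (@continuous_comp _ _ _ snd snd); exact: cvg_snd.
apply: cvgD; apply: cvgZ => //; last exact: cvg_fst.
by apply: cvgB; [exact: cvg_cst|exact: cvg_fst].
Qed.

Section compact_hull.
Context (R : realType) (n : nat).
Implicit Type A : set 'rV[R]_n.

(* Convex combinations of k + 1 points of A, presented so that compactness is
   preserved at each step. *)
Fixpoint iter_join A k : set 'rV[R]_n :=
  if k is k'.+1 then
    [set (1 - t.1) *: t.2.1 + t.1 *: t.2.2 |
       t in `[0%R, 1%R]%classic `*` (iter_join A k' `*` A)]
  else A.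

Lemma compact_iter_join A k : compact A -> compact (iter_join A k).
Proof.
move=> cA; elim: k => //= k IH; apply: continuous_compact.
  apply: continuous_subspaceT => t.
  exact: continuous_segment.
apply: compact_setX; first exact: segment_compact.
exact: compact_setX.
Qed.

Lemma subset_iter_join A k : A `<=` iter_join A k.
Proof.
elim: k => //= k IH a Aa; exists (1, (a, a)) => /=.
  by split; [rewrite /= in_itv/= lexx ler01|split => //; exact: IH].
by rewrite subrr scale0r add0r scale1r.
Qed.

Lemma iter_joinS A k : iter_join A k `<=` iter_join A k.+1.
Proof.
have [->|/set0P[b Ab]] := eqVneq A set0; last first.
  move=> a Aa; exists (0, (a, b)) => /=.
    by split => //=; rewrite in_itv/= lexx ler01.
  by rewrite subr0 scale0r addr0 scale1r.
suff -> : iter_join set0 k = set0 by move=> x [].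
by elim: k => //= k ->; apply/seteqP; split => // x [t [_ []]].
Qed.

Lemma iter_join_convex A k (a : 'I_k.+1 -> 'rV[R]_n) (w : 'I_k.+1 -> R) :
  (forall i, A (a i)) -> (forall i, 0 <= w i) -> \sum_i w i = 1 ->
  iter_join A k (\sum_i w i *: a i).
Proof.
elim: k => [|k IH] in a w * => Aa w0 w1.
  by move: w1; rewrite !big_ord1 => ->; rewrite scale1r; exact: Aa.
pose t := w ord_max; pose s := \sum_(i < k.+1) w (widen_ord (leqnSn k.+1) i).
have st : s + t = 1 by rewrite -w1 big_ord_recr.
have s0 : 0 <= s by apply: sumr_ge0.
(* If [s] vanishes, all the weight sits on the last point; otherwise the other weights are rescaled
   by [s] to sum to 1. *)
have [s00|sn0] := eqVneq s 0.
  apply: subset_iter_join.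
  have t1 : t = 1 by rewrite -st s00 add0r.
  rewrite big_ord_recr big1/= ?add0r; first by rewrite -/t t1 scale1r;
    exact: Aa.
  move=> i _; have /eqP := s00; rewrite psumr_eq0// =>
    /allP/(_ i (mem_index_enum _))/eqP ->.
  by rewrite scale0r.
pose w' i := w (widen_ord (leqnSn k.+1) i) / s.
pose a' i := a (widen_ord (leqnSn k.+1) i).
exists (t, (\sum_i w' i *: a' i, a ord_max)) => /=.
  split; first by rewrite /= in_itv/= w0/= -st lerDr.
  split; last exact: Aa.
  apply: IH; first by move=> i; exact: Aa.
    by move=> i; rewrite divr_ge0.
  by rewrite -mulr_suml divff.
rewrite [RHS]big_ord_recr/=; congr (_ + _).
rewrite (_ : 1 - t = s); last by rewrite -st addrK.
rewrite scaler_sumr; apply: eq_bigr => i _.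
by rewrite scalerA /w' mulrCA divff// mulr1.
Qed.

Lemma iter_join_sub_hull A k : iter_join A k `<=` convex_hull A.
Proof.
elim: k => [a Aa|k IH _ [[t [a b]] [/= + [ka Ab]] <-]]/=.
  exists 1%N, (fun=> a), (fun=> 1); split => //.
    by rewrite big_ord1.
  by rewrite big_ord1 scale1r.
rewrite in_itv/= => /andP[t0 t1].
have [l [c [w [Ac w0 w1 ->]]]] := IH _ ka.
exists l.+1, (fun i => if unlift ord_max i is Some j then c j else b),
  (fun i => if unlift ord_max i is Some j then (1 - t) * w j else t); split.
- by move=> i; case: unliftP.
- by move=> i; case: unliftP => // j _; rewrite mulr_ge0 ?subr_ge0.
- rewrite (bigD1_ord ord_max)//= unlift_none.
  under eq_bigr do rewrite liftK.
  by rewrite -mulr_sumr w1 mulr1 addrC subrK.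
- rewrite (bigD1_ord ord_max)//= unlift_none addrC; congr (_ + _).
  rewrite scaler_sumr; apply: eq_bigr => i _.
  by rewrite liftK scalerA.
Qed.

(** More than [n + 1] points are affinely dependent, and moving the weights along the dependency
    until one of them vanishes removes a point. Bounding the number of joins by [n] is what makes
    the hull compact. *)
Lemma caratheodory A : convex_hull A `<=` iter_join A n.
Proof.
move=> _ [k [a [w [Aa w0 w1 ->]]]].
case: k => [|k] in a w Aa w0 w1 *.
  by move: w1; rewrite big_ord0 => /esym/eqP; rewrite oner_eq0.
elim: k => [|k IH] in a w Aa w0 w1 *.
  by rewrite big_ord1; move: w1; rewrite big_ord1 => ->; rewrite scale1r;
    exact/subset_iter_join.
have [kn|nk] := leqP k.+1 n.
  have mono l : (k.+1 <= l)%N -> iter_join A k.+1 `<=` iter_join A l.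
    elim: l => // l IHl; rewrite leq_eqVlt ltnS => /predU1P[->//|/IHl h].
    by apply: subset_trans h _; exact: iter_joinS.
  by apply: (mono _ kn); exact: iter_join_convex.
(* The column of ones forces the coefficients of a linear relation to sum to 0. There are [k.+2]
   rows against [n + 1] columns, and [n <= k], so a nonzero relation exists. *)
pose M := row_mx (\matrix_i a i) (const_mx 1 : 'M[R]_(k.+2, 1)).
have [l lM l0] : exists2 l : 'rV[R]_k.+2, (l <= kermx M)%MS & l != 0.
  apply/rowV0Pn; rewrite -mxrank_eq0 mxrank_ker -lt0n subn_gt0.
  by rewrite (leq_ltn_trans (rank_leq_col M))// addn1.
move/sub_kermxP : lM; rewrite mul_mx_row -row_mx0 => /eq_row_mx[la l1].
have {}la : \sum_i l ord0 i *: a i = 0.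
  by rewrite -[RHS]la mulmx_sum_row; apply: eq_bigr => i _; rewrite rowK.
have {}l1 : \sum_i l ord0 i = 0.
  have /matrixP/(_ ord0 ord0) := l1; rewrite !mxE => l1'; rewrite -[RHS]l1'.
  by apply: eq_bigr => i _; rewrite mxE mulr1.
have [i0 i0P] : exists i, 0 < l ord0 i.
  apply: contrapT => /forallNP l_le0; move/eqP : l0; apply; apply/rowP => i.
  rewrite mxE; apply/eqP; rewrite -oppr_eq0.
  have : \sum_i - l ord0 i == 0 by rewrite sumrN l1 oppr0.
  rewrite psumr_eq0; first by move/allP/(_ i (mem_index_enum _)).
  by move=> {}i _; rewrite oppr_ge0 leNgt; exact/negP.
pose j := [arg min_(i < i0 | 0 < l ord0 i) (w i / l ord0 i)]%O.
have [lj jmin] : 0 < l ord0 j /\ forall i, 0 < l ord0 i ->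
  w j / l ord0 j <= w i / l ord0 i.
  by rewrite /j; case: arg_minP.
(* The largest multiple of [l] that can be subtracted while all weights stay nonnegative; it cancels
   the weight of [j]. *)
pose r := w j / l ord0 j.
pose w' i := w i - r * l ord0 i.
have w'j : w' j = 0 by rewrite /w' /r divfK ?subrr// gt_eqF.
have -> : \sum_i w i *: a i = \sum_i w' (lift j i) *: a (lift j i).
  transitivity (\sum_i w' i *: a i).
    under [RHS]eq_bigr do rewrite scalerBl -scalerA.
    by rewrite sumrB -scaler_sumr la scaler0 subr0.
  by rewrite (bigD1_ord j)//= w'j scale0r add0r.
apply: IH.
- by move=> i; exact: Aa.
- move=> i; rewrite /w' subr_ge0.
  have [li|li] := ltP 0 (l ord0 (lift j i)).
    by rewrite -ler_pdivlMr//; exact: jmin.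
  by apply: le_trans (w0 _); rewrite mulr_ge0_le0// divr_ge0// ltW.
- transitivity (\sum_i w' i); first by rewrite [RHS](bigD1_ord j)//= w'j add0r.
  by rewrite sumrB w1 -mulr_sumr l1 mulr0 subr0.
Qed.

Lemma compact_convex_hull A : compact A -> compact (convex_hull A).
Proof.
move=> cA; rewrite (_ : convex_hull A = iter_join A n).
  exact: compact_iter_join.
by apply/seteqP; split; [exact: caratheodory|exact: iter_join_sub_hull].
Qed.

End compact_hull.

(** * Uniform continuity in the average action *)

Section uniform_continuity.
Context (R : realType) (n : nat) (T : topologicalType) (C : nonempty_set
  'rV[R]_n).
Variable phi : T -> points C -> R.
Hypotheses (compactT : compact [set: T]) (compactC : compact [set: points C]).
Hypothesis phi_continuous : continuous (fun z : T * points C => phi z.1 z.2).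

Lemma nbhs_points (v : points C) (B : set (points C)) : nbhs v B ->
  exists2 r : R, 0 < r & forall v' : points C,
    (forall j, `|set_val v ord0 j - set_val v' ord0 j| < r) -> B v'.
Proof.
rewrite (@nbhsE (initial_topology (@set_val _ C))) => -[W [[D oD <-] Dv] WB].
have /nbhs_ballP[r /= r0 rD] : nbhs (set_val v) D by exact: open_nbhs_nbhs.
exists r => // v' vv'; apply/WB/rD; split => // i j.
by rewrite (ord1 i); exact: vv'.
Qed.

(** [points C] is given only a topology, so closeness is measured on coordinates and the
    Heine-Cantor argument uses compactness of the product in its near-covering form, with [r]
    tending to 0 from the right. One half of the local radius is for the base point, the other for
    its perturbation. *)
Lemma uniformly_continuous_snd (e : R) : 0 < e ->
  exists2 r : R, 0 < r & forall u (v v' : points C),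
    (forall j, `|set_val v ord0 j - set_val v' ord0 j| < r) ->
    `|phi u v - phi u v'| < e.
Proof.
move=> e0.
have /compact_near_coveringP cTC : compact [set: T * points C].
  by rewrite -setXTT; exact: compact_setX.
pose Pr (r : R) (z : T * points C) := forall v' : points C,
  (forall j, `|set_val z.2 ord0 j - set_val v' ord0 j| < r) ->
    `|phi z.1 z.2 - phi z.1 v'| < e.
have : \forall r \near 0^'+, [set: T * points C] `<=` Pr r.
  apply: cTC => -[u v] _.
  have e20 : 0 < e / 2 by rewrite divr_gt0.
  have [[A B] /= [Au Bv] AB] :
      \forall z \near (u, v), `|phi u v - phi z.1 z.2| < e / 2.
    by have /cvgr_dist_lt := @phi_continuous (u, v); exact.
  have [r r0 rB] := nbhs_points Bv.
  have r20 : 0 < r / 2 by rewrite divr_gt0.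
  pose B' := [set v1 : points C |
    forall j, `|set_val v ord0 j - set_val v1 ord0 j| < r / 2].
  exists (A `*` B', [set s | s < r / 2]).
    split; last exact: nbhs_right_lt.
    exists (A, B') => //=.
    split => //.
    have h : nbhs v ((fun v1 : points C =>
      set_val v1) @^-1` ball (set_val v) (r / 2)).
      apply: (@initial_continuous _ _ (@set_val _ C) v).
      exact: nbhsx_ballx.
    by apply: filterS h => v1 [_ vv1] j; exact: vv1.
  move=> [[u1 v1] s] /= [[Au1 v1r] sr] v' v1v'.
  rewrite (splitr e) -(subrKA (phi u v)); apply: le_lt_trans (ler_normD _ _) _.
  apply: ltrD.
    rewrite distrC; apply: (AB (u1, v1)); split => //=; apply: rB => j.
    by apply: lt_trans (v1r j) _; rewrite ltr_pdivrMr// mulr_natr mulr2n ltrDl.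
  apply: (AB (u1, v')); split => //=; apply: rB => j.
  rewrite (splitr r) -(subrKA (set_val v1 ord0 j)).
  apply: le_lt_trans (ler_normD _ _) _; apply: ltrD => //.
  exact: lt_trans (v1v' j) sr.
move=> near_r.
have [r [r0 rP]] : exists r : R, 0 < r /\ [set: T * points C] `<=` Pr r.
  have /filter_ex[r [? ?]] : \forall r \near 0^'+,
    0 < r /\ [set: T * points C] `<=` Pr r.
    by apply: filterI near_r; exact: nbhs_right_gt.
  by exists r.
by exists r => // u v v' vv'; exact: (rP (u, v) I).
Qed.

End uniform_continuity.

Lemma bounded_coord (R : realType) n (U : nonempty_set 'rV[R]_n) :
  compact (U : set 'rV[R]_n) ->
  exists2 K : R, 0 < K & forall (u : points U) j, `|set_val u ord0 j| <= K.
Proof.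
move=> /compact_bounded[K [_ UK]]; exists (Num.max K 0 + 1) => [|u j].
  by rewrite ltr_wpDl// le_max lexx orbT.
apply: le_trans (UK _ _ _ (set_valP u)); last by rewrite ltr_pwDr// le_max lexx.
rewrite [leRHS]/Num.norm/= mx_normrE; apply/bigmax_geP; right => /=.
by exists (ord0, j).
Qed.

(** * Law of large numbers *)

Section bounded_integrals.
Context d (T : measurableType d) (R : realType) (P : probability T R).

Lemma bounded_integrable (f : T -> R) (K : R) :
  measurable_fun [set: T] f -> (forall u, `|f u| <= K) ->
  P.-integrable [set: T] (EFin \o f).
Proof.
move=> mf fK; apply: measurable_bounded_integrable => //.
  exact: fin_num_fun_lty.
exists K; split; first exact: num_real.
by move=> M KM u _; exact: le_trans (fK u) (ltW KM).
Qed.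

Lemma EFin_Rintegral (f : T -> R) (K : R) :
  measurable_fun [set: T] f -> (forall u, `|f u| <= K) ->
  (\int[P]_u (f u)%:E = (\int[P]_u f u)%R%:E)%E.
Proof.
move=> mf fK; rewrite /Rintegral fineK//.
by apply: integrable_fin_num => //; exact: bounded_integrable fK.
Qed.

Lemma integral_cst_probability (c : \bar R) : (\int[P]_u c = c)%E.
Proof. by rewrite integral_cst// [X in (c * X)%E](@probability_setT _ _ _ P)
  mule1. Qed.

Lemma integral_affine (f : T -> R) (K a b : R) :
  measurable_fun [set: T] f -> (forall u, `|f u| <= K) ->
  (\int[P]_u (a + b * f u)%:E = (a + b * (\int[P]_u f u)%R)%:E)%E.
Proof.
move=> mf fK; have fi := bounded_integrable mf fK.
under eq_integral do rewrite EFinD EFinM.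
rewrite integralD//; last 2 first.
- exact: finite_measure_integrable_cst.
- exact: integrableZl.
rewrite integralZl// integral_cst//=. rewrite probability_setT mule1.
by rewrite (EFin_Rintegral mf fK).
Qed.

End bounded_integrals.

Section product_law_moments.
Context d (T : measurableType d) (R : realType).

(* The shift by t is what the induction on N needs. *)
Lemma second_moment_product_law N (P : 'I_N -> probability T R)
    (a : 'I_N -> T -> R) (K t : R) :
  (forall i, measurable_fun [set: T] (a i)) -> (forall i u, `|a i u| <= K) ->
  (forall i, \int[P i]_u a i u = 0) ->
  (\int[product_law P]_u ((t + \sum_i a i (tnth u i)) ^+ 2)%:E <=
   (t ^+ 2 + N%:R * K ^+ 2)%:E)%E.
Proof.
elim: N => [|N IH] in P a t * => ma aK a0.
  rewrite integral_dirac//=.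
    by rewrite diracE in_setT mul1e big_ord0 addr0 mul0r addr0.
  by under eq_fun do rewrite big_ord0; exact: measurable_cst.
have msum M (b : 'I_M -> T -> R) (s : R) : (forall i,
  measurable_fun setT (b i)) ->
    measurable_fun [set: M.-tuple T] (fun u =>
      ((s + \sum_i b i (tnth u i)) ^+ 2)%:E).
  move=> mb; apply/measurable_EFinP; apply: measurable_funX.
  apply: measurable_funD => //; apply: measurable_sum => i.
  exact: (measurableT_comp (mb i) (measurable_tnth i)).
rewrite integral_product_lawS//; last 2 first.
- by move=> u; rewrite lee_fin sqr_ge0.
- exact: msum.
pose b i := a (lift ord0 i).
under eq_integral => x _.
  under eq_integral => u _.
    rewrite big_ord_recl tnth0 addrA.
    under eq_bigr do rewrite tnthS.
    over.
  over.
(* Only the square of [a ord0 x] is bounded, by [K ^+ 2]; the cross term stays linear in [a ord0 x]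
   and integrates to 0. *)
apply: (@le_trans _ _
  (\int[P ord0]_x ((t ^+ 2 + N.+1%:R * K ^+ 2) + t *+ 2 * a ord0 x)%:E)%E);
    last first.
  by rewrite (integral_affine _ _ _ (ma ord0) (aK ord0)) a0 mulr0 addr0.
have le1 x : (\int[product_law (fun i => P (lift ord0 i))]_u
    (((t + a ord0 x) + \sum_i b i (tnth u i)) ^+ 2)%:E <=
    ((t + a ord0 x) ^+ 2 + N%:R * K ^+ 2)%:E)%E.
  exact: (IH (fun i => P (lift ord0 i)) b (t + a ord0 x) (fun i => ma _)
    (fun i => aK _) (fun i => a0 (lift ord0 i))).
have mb : measurable_fun [set: T] (fun x =>
  ((t + a ord0 x) ^+ 2 + N%:R * K ^+ 2)%:E).
  apply/measurable_EFinP; apply: measurable_funD => //.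
  by apply: measurable_funX; apply: measurable_funD.
apply: le_trans (@ge0_le_integral _ _ _ (P ord0) _ measurableT _ _ _ _ mb (fun x
  _ => le1 x)) _.
- by move=> x _; apply: integral_ge0 => u _; rewrite lee_fin sqr_ge0.
- apply: (@measurable_fun_fubini_tonelli_F _ _ _ _ _ _ (fun z =>
    ((t + a ord0 z.1 +
    \sum_i b i (tnth z.2 i)) ^+ 2)%:E)); last first.
    by move=> z; rewrite lee_fin sqr_ge0.
  apply/measurable_EFinP; apply: measurable_funX; apply: measurable_funD => /=.
    by apply: measurable_funD => //; exact: (measurableT_comp (ma ord0)).
  apply: measurable_sum => i.
  apply: (measurableT_comp (ma (lift ord0 i))).
  exact: (measurableT_comp (measurable_tnth i)).
- have K2 x : a ord0 x ^+ 2 <= K ^+ 2.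
    by rewrite -ler_sqrt ?sqr_ge0// !sqrtr_sqr; exact: le_trans (ler_norm _).
  have le2 x : (t + a ord0 x) ^+ 2 + N%:R * K ^+ 2 <=
      t ^+ 2 + N.+1%:R * K ^+ 2 + t *+ 2 * a ord0 x.
    by have := K2 x; rewrite -natr1 -mulr_natr; lra.
  have ge2 x : 0 <= (t + a ord0 x) ^+ 2 + N%:R * K ^+ 2.
    by apply: addr_ge0; [|apply: mulr_ge0]; rewrite ?sqr_ge0 ?ler0n.
  apply: ge0_le_integral => //.
  + by move=> x _; rewrite lee_fin.
  + apply/measurable_EFinP; apply: measurable_funD => //.
    exact: measurable_funM.
  + by move=> x _; rewrite lee_fin.
Qed.

Lemma integral_product_law_tnth N (P : 'I_N -> probability T R) i f :
  (forall t, 0 <= f t)%E -> measurable_fun [set: T] f ->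
  (\int[product_law P]_u f (tnth u i) = \int[P i]_t f t)%E.
Proof.
elim: N => [|N IH] in P i *; first by case: i.
move=> f0 mf; rewrite integral_product_lawS//; last first.
  exact: (measurableT_comp mf (measurable_tnth i)).
case: (unliftP ord0 i) => [j|] ->.
  under eq_integral.
    move=> t _; under eq_integral do rewrite tnthS.
    rewrite IH//; over.
  by rewrite integral_cst_probability.
apply: eq_integral => t _; rewrite -[RHS](integral_cst_probability
  (product_law (fun i => P (lift ord0 i)))).
by apply: eq_integral => u _; rewrite tnth0.
Qed.

End product_law_moments.

(** * Averages of measures *)

Section average_measure.
Context d (T : measurableType d) (R : realType) (N : nat).

Local Open Scope ereal_scope.

(** A relation rather than a construction, since it must also hold of the action law of an averaged
    policy, which is built from a kernel chosen separately. *)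
Definition is_average (mu : set T -> \bar R) (nu : 'I_N.+1 -> set T ->
  \bar R) :=
  forall A, measurable A -> mu A = (N.+1%:R^-1)%:E * \sum_(i < N.+1) nu i A.

Definition average_measure (nu : 'I_N.+1 -> {measure set T -> \bar R}) :
    {measure set T -> \bar R} :=
  mscale (N.+1%:R^-1 : R)%:nng%R
    (msum (fun k => nu (inord k)) N.+1).

Lemma average_measureE nu : is_average (average_measure nu) nu.
Proof.
move=> A mA; rewrite /average_measure/= /mscale/= /msum; congr (_ * _).
by apply: eq_bigr => i _; rewrite inord_val.
Qed.

Lemma ge0_integral_average (mu : {measure set T -> \bar R})
    (nu : 'I_N.+1 -> {measure set T -> \bar R}) f :
  is_average mu nu -> (forall t, 0 <= f t) -> measurable_fun [set: T] f ->
  \int[mu]_t f t = (N.+1%:R^-1)%:E * \sum_(i < N.+1) \int[nu i]_t f t.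
Proof.
move=> avg f0 mf; rewrite (eq_measure_integral (average_measure nu)).
  rewrite ge0_integral_mscale// ge0_integral_measure_sum//; congr (_ * _).
  by apply: eq_bigr => i _; rewrite inord_val.
by move=> A mA _; rewrite avg// average_measureE.
Qed.

Lemma Rintegral_average (mu : probability T R) (nu : 'I_N.+1 -> probability T R)
    (f : T -> R) (K : R) :
  is_average mu (fun i => nu i) -> measurable_fun [set: T] f ->
    (forall t, (`|f t| <= K)%R) ->
  (\int[mu]_t f t = N.+1%:R^-1 * \sum_(i < N.+1) \int[nu i]_t f t)%R.
Proof.
move=> avg mf fK; apply/EFin_inj.
(* Adding [K] makes the integrand nonnegative; as all the measures are probabilities, the same
   constant appears on both sides and cancels. *)
have mKf : measurable_fun [set: T] (fun t => (K + 1 * f t)%:E).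
  by apply/measurable_EFinP; apply: measurable_funD => //;
    exact: measurable_funM.
have Kf0 t : 0 <= (K + 1 * f t)%:E.
  by rewrite lee_fin mul1r -lerBlDl sub0r; have := fK t;
    rewrite ler_norml => /andP[].
have := ge0_integral_average avg Kf0 mKf.
rewrite (integral_affine _ _ _ mf fK).
under eq_bigr do rewrite (integral_affine _ _ _ mf fK).
rewrite sumEFin -EFinM => -[]; rewrite mul1r.
under eq_bigr do rewrite mul1r.
rewrite big_split/= sumr_const card_ord mulrDr -[X in (_ * X + _)%R]mulr_natr.
by rewrite mulrCA mulVf ?pnatr_eq0// mulr1 => /addrI ->.
Qed.

End average_measure.

(** * Concentration of the average action *)

Section mean_field.
Context (R : realType) (n : nat) (U : nonempty_set 'rV[R]_n).

Lemma measurable_average N :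
  measurable_fun [set: N.+1.-tuple (points U)] (@average R n U N).
Proof.
apply: measurable_to_points => j.
rewrite [X in measurable_fun _ X](_ : _ =
    fun u : N.+1.-tuple (points U) =>
      N.+1%:R^-1 * \sum_(p < N.+1) set_val (tnth u p) ord0 j).
  apply: measurable_funM => //; apply: measurable_sum => p.
  apply: (@measurableT_comp _ _ _ _ _ _ (fun v : points U => set_val v ord0 j)).
    exact: measurable_coord.
  exact: measurable_tnth.
by apply/funext => u; rewrite /= mxE summxE.
Qed.

Lemma measurable_average_coord N j :
  measurable_fun [set: N.+1.-tuple (points U)]
    (fun u => set_val (average u) ord0 j).
Proof.
apply: (@measurableT_comp _ _ _ _ _ _ (fun v : points (conv_hull U) =>
  set_val v ord0 j)); first exact: measurable_coord.
exact: measurable_average.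
Qed.

Definition barycenter (nu : probability (points U) R) (j : 'I_n) : R :=
  \int[nu]_u (set_val u ord0 j).

Definition dispersion N (nu : probability (points U) R)
    (u : N.+1.-tuple (points U)) : R :=
  \sum_(j < n) (set_val (average u) ord0 j - barycenter nu j) ^+ 2.

Lemma measurable_dispersion N nu : measurable_fun setT (@dispersion N nu).
Proof.
apply: measurable_sum => j; apply: measurable_funX;
  apply: measurable_funB => //.
exact: measurable_average_coord.
Qed.

Lemma dispersion_ge0 N nu u : 0 <= @dispersion N nu u.
Proof. by apply: sumr_ge0 => j _; exact: sqr_ge0. Qed.

Variable K : R.
Hypothesis UK : forall (u : points U) j, `|set_val u ord0 j| <= K.

(** Each action is centered at the barycenter of its own law, and these centers average to the
    barycenter of [nubar]. A centered coordinate is at most [K *+ 2] in absolute value, so each of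
    the [n] coordinates contributes [(K *+ 2) ^+ 2 / N.+1]. *)
Lemma weak_law N (nu : 'I_N.+1 -> probability (points U) R)
    (nubar : probability (points U) R) :
  is_average nubar (fun i => nu i) ->
  (\int[product_law nu]_u (dispersion nubar u)%:E <=
   (n%:R * (K *+ 2) ^+ 2 / N.+1%:R)%:E)%E.
Proof.
move=> avg; rewrite /dispersion.
under eq_integral do rewrite -sumEFin.
have mcoord j : measurable_fun [set: points U] (fun u => set_val u ord0 j).
  exact: measurable_coord.
have mterm j : measurable_fun [set: N.+1.-tuple (points U)]
    (fun u => ((set_val (average u) ord0 j - barycenter nubar j) ^+ 2)%:E).
  apply/measurable_EFinP; apply: measurable_funX; apply: measurable_funB => //.
  exact: measurable_average_coord.
rewrite ge0_integral_sum//; last by move=> j u _; rewrite lee_fin sqr_ge0.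
rewrite -mulrA mulr_natl -[X in _ *+ X](card_ord n) -sumr_const -sumEFin.
apply: lee_sum => j _.
pose a i (u : points U) : R := set_val u ord0 j - barycenter (nu i) j.
have bK i : `|barycenter (nu i) j| <= K.
  have fi := bounded_integrable (nu i) (mcoord j) (fun u => UK u j).
  apply: le_trans (le_normr_Rintegral _ fi) _ => //.
  rewrite -lee_fin -(EFin_Rintegral _ (K := K)); last 2 first.
  - exact: measurableT_comp.
  - by move=> u; rewrite normr_id.
  rewrite -[leRHS](integral_cst_probability (nu i)).
  apply: ge0_le_integral => //.
  - by apply/measurable_EFinP; exact: measurableT_comp.
  - by move=> u _; rewrite lee_fin.
have ma i : measurable_fun [set: points U] (a i) by apply: measurable_funB.
have aK i u : `|a i u| <= K *+ 2.
  by rewrite mulr2n; apply: le_trans (ler_normB _ _) _; apply: lerD.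
have a0 i : \int[nu i]_u a i u = 0.
  rewrite RintegralB//; last 2 first.
  - exact: bounded_integrable (mcoord j) (fun u => UK u j).
  - exact: finite_measure_integrable_cst.
  rewrite Rintegral_cst// [X in fine X](@probability_setT _ _ _ (nu i)) mulr1.
  by rewrite subrr.
have := second_moment_product_law 0 ma aK a0.
rewrite expr0n add0r => sm.
have -> : (fun u => ((set_val (average u) ord0 j - barycenter nubar j) ^+ 2)%:E)
  =
    (fun u => (N.+1%:R^-1 ^+ 2)%:E * ((0 + \sum_i a i (tnth u i)) ^+ 2)%:E)%E.
  apply/funext => u; rewrite -EFinM -exprMn add0r; congr ((_ ^+ 2)%:E).
  have -> : barycenter nubar j = N.+1%:R^-1 * \sum_i barycenter (nu i) j.
    exact: (Rintegral_average avg (mcoord j) (fun t => UK t j)).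
  rewrite mxE summxE -mulrBr.
  by rewrite -sumrB.
rewrite ge0_integralZl//; last 2 first.
- apply/measurable_EFinP; apply: measurable_funX; apply: measurable_funD => //.
  apply: measurable_sum => i.
  by apply: (measurableT_comp (ma i)); exact: measurable_tnth.
- by move=> u _; rewrite lee_fin sqr_ge0.
apply: le_trans (lee_pmul _ _ (lexx _) sm) _.
- by rewrite lee_fin sqr_ge0.
- by apply: integral_ge0 => u _; rewrite lee_fin sqr_ge0.
rewrite -EFinM lee_fin expr2 -mulrA mulKf ?pnatr_eq0//.
by rewrite mulrC.
Qed.

End mean_field.

(** * Mean-field limit for fixed omega_0 *)

Section mean_field_limit.
Context (R : realType) (n : nat) (U : nonempty_set 'rV[R]_n).
Local Notation C := (conv_hull U).
Variables (phi : points U -> points C -> R) (M : R).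
Hypothesis mphi : measurable_fun [set: points U * points C] (fun z =>
  phi z.1 z.2).
Hypothesis phi0 : forall u v, 0 <= phi u v.
Hypothesis phiM : forall u v, phi u v <= M.

Definition mean_cost N (u : N.+1.-tuple (points U)) : R :=
  N.+1%:R^-1 * \sum_(i < N.+1) phi (tnth u i) (average u).

Lemma mean_le N (g : 'I_N.+1 -> R) (b : R) : (forall i, g i <= b) ->
  N.+1%:R^-1 * \sum_i g i <= b.
Proof.
move=> gb; rewrite mulrC ler_pdivrMr ?ltr0n// -[N.+1 in leRHS]card_ord.
rewrite mulr_natr -sumr_const; exact: ler_sum.
Qed.

Lemma mean_cost_ge0 N u : 0 <= @mean_cost N u.
Proof. by rewrite mulr_ge0// ?invr_ge0//; apply: sumr_ge0. Qed.

Lemma mean_cost_le N u : @mean_cost N u <= M.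
Proof. by apply: mean_le => i. Qed.

Lemma measurable_mean_cost N : measurable_fun setT (@mean_cost N).
Proof.
apply: measurable_funM => //; apply: measurable_sum => i.
apply: (@measurableT_comp _ _ _ _ _ _ (fun z => phi z.1 z.2) _
  (fun u : N.+1.-tuple (points U) => (tnth u i, average u))) => //.
apply: measurable_fun_pair; first exact: measurable_tnth.
exact: measurable_average.
Qed.

Definition frozen_cost N (v : points C) (u : N.+1.-tuple (points U)) : R :=
  N.+1%:R^-1 * \sum_(i < N.+1) phi (tnth u i) v.

Lemma frozen_cost_ge0 N v u : 0 <= @frozen_cost N v u.
Proof. by rewrite mulr_ge0// ?invr_ge0//; apply: sumr_ge0. Qed.

Lemma measurable_phi_fst v : measurable_fun [set: points U] (phi ^~ v).
Proof. exact: (measurableT_comp mphi (pair2_measurable v)). Qed.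

Lemma measurable_frozen_cost N v : measurable_fun setT (@frozen_cost N v).
Proof.
apply: measurable_funM => //; apply: measurable_sum => i.
exact: (measurableT_comp (measurable_phi_fst v) (measurable_tnth i)).
Qed.

(** With the second argument frozen, the cost is a mean of functions of single actions, so it sees
    the laws [nu i] only through their average. This is why a profile can be replaced by its
    averaged policy. *)
Lemma integral_frozen_cost N v (nu : 'I_N.+1 -> probability (points U) R)
    (nubar : probability (points U) R) :
  is_average nubar (fun i => nu i) ->
  (\int[product_law nu]_u (frozen_cost v u)%:E = \int[nubar]_t (phi t v)%:E)%E.
Proof.
move=> avg.
have mv : measurable_fun [set: points U] (fun t => (phi t v)%:E).
  by apply/measurable_EFinP; exact: measurable_phi_fst.
have v0 t : (0 <= (phi t v)%:E)%E by rewrite lee_fin.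
rewrite (ge0_integral_average avg)//.
under eq_integral do rewrite EFinM -sumEFin.
rewrite ge0_integralZl//; last 2 first.
- by apply: emeasurable_sum => i;
    exact: (measurableT_comp mv (measurable_tnth i)).
- by move=> u _; apply: sume_ge0.
rewrite ge0_integral_sum//; last first.
  by move=> i; exact: (measurableT_comp mv (measurable_tnth i)).
congr (_ * _)%E; apply: eq_bigr => i _.
exact: (integral_product_law_tnth _ i (f := fun t => (phi t v)%:E)).
Qed.

Variables (e r : R).
Hypotheses (e0 : 0 <= e) (r0 : 0 < r).
Hypothesis phi_modulus : forall u (v v' : points C),
  (forall j, `|set_val v ord0 j - set_val v' ord0 j| < r) ->
  `|phi u v - phi u v'| <= e.

(** Chebyshev's argument before integration: if the average is near the barycenter, the modulus
    gives [e]; otherwise some coordinate is off by [r / 2], so the dispersion is at least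
    [(r / 2) ^+ 2] and its multiple dominates the trivial bound [M]. *)
Lemma cost_difference N (nubar : probability (points U) R) (v : points C)
    (u : N.+1.-tuple (points U)) i :
  (forall j, `|set_val v ord0 j - barycenter nubar j| < r / 2) ->
  `|phi (tnth u i) (average u) - phi (tnth u i) v| <=
  e + M * 4 / r ^+ 2 * dispersion nubar u.
Proof.
move=> vm; have M0 : 0 <= M := le_trans (phi0 _ _) (phiM (tnth u i) v).
have [near_m|far_m] := pselect
  (forall j, `|set_val (average u) ord0 j - barycenter nubar j| < r / 2).
  rewrite -[leLHS]addr0 lerD//; last first.
    by rewrite mulr_ge0 ?dispersion_ge0// divr_ge0 ?sqr_ge0// mulr_ge0.
  apply: phi_modulus => j; rewrite (splitr r) -(subrKA (barycenter nubar j)).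
  apply: le_lt_trans (ler_normD _ _) _; rewrite ltrD//.
  by rewrite distrC; exact: vm.
have {far_m}[j /negP] : exists j,
    ~ `|set_val (average u) ord0 j - barycenter nubar j| < r / 2.
  exact/existsNP.
rewrite -leNgt => rj.
have r2 : (r / 2) ^+ 2 <= dispersion nubar u.
  rewrite /dispersion (bigD1 j)//= -[leLHS]addr0 lerD//.
    by rewrite -[leRHS]real_normK ?num_real// ler_sqr ?nnegrE// divr_ge0// ltW.
  by apply: sumr_ge0 => k _; exact: sqr_ge0.
apply: (@le_trans _ _ M).
  have := phi0 (tnth u i) (average u); have := phiM (tnth u i) (average u).
  have := phi0 (tnth u i) v; have := phiM (tnth u i) v.
  by rewrite ler_norml => *; apply/andP; split; lra.
rewrite -[leLHS]add0r lerD//.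
rewrite [leLHS](_ : M = M * 4 / r ^+ 2 * (r / 2) ^+ 2); last first.
  by field; rewrite gt_eqF.
apply: ler_wpM2l => //.
by rewrite divr_ge0 ?sqr_ge0// mulr_ge0.
Qed.

Variable K : R.
Hypothesis UK : forall (u : points U) j, `|set_val u ord0 j| <= K.

Definition mean_field_error N : R :=
  e + M * 4 / r ^+ 2 * (n%:R * (K *+ 2) ^+ 2 / N.+1%:R).

Lemma mean_cost_estimate N (v : points C) (nu : 'I_N.+1 ->
  probability (points U) R)
    (nubar : probability (points U) R) :
  is_average nubar (fun i => nu i) ->
  (forall j, `|set_val v ord0 j - barycenter nubar j| < r / 2) ->
  (\int[product_law nu]_u (mean_cost u)%:E <=
     \int[nubar]_t (phi t v)%:E + (mean_field_error N)%:E)%E /\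
  (\int[nubar]_t (phi t v)%:E <=
     \int[product_law nu]_u (mean_cost u)%:E + (mean_field_error N)%:E)%E.
Proof.
move=> avg vm.
have M0 : 0 <= M := le_trans (phi0 point v) (phiM point v).
have Mr0 : 0 <= M * 4 / r ^+ 2 by rewrite divr_ge0 ?sqr_ge0// mulr_ge0.
rewrite -(integral_frozen_cost v avg).
have aux (g h : N.+1.-tuple (points U) -> R) :
    measurable_fun setT g -> measurable_fun setT h ->
    (forall u, 0 <= g u) -> (forall u, 0 <= h u) ->
    (forall u, g u <= h u + (e + M * 4 / r ^+ 2 * dispersion nubar u)) ->
    (\int[product_law nu]_u (g u)%:E <=
      \int[product_law nu]_u (h u)%:E + (mean_field_error N)%:E)%E.
  move=> mg mh g0 h0 gh.
  have md : measurable_fun setT (fun u : N.+1.-tuple (points U) =>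
    (dispersion nubar u)%:E).
    by apply/measurable_EFinP; exact: measurable_dispersion.
  have me : measurable_fun setT (fun u : N.+1.-tuple (points U) =>
      (e%:E + (M * 4 / r ^+ 2)%:E * (dispersion nubar u)%:E)%E).
    by apply: emeasurable_funD => //; exact: measurable_funeM.
  have d0 (u : N.+1.-tuple (points U)) : (0 <= (dispersion nubar u)%:E)%E.
    by rewrite lee_fin dispersion_ge0.
  apply: (@le_trans _ _ (\int[product_law nu]_u ((h u)%:E + (e%:E +
      (M * 4 / r ^+ 2)%:E * (dispersion nubar u)%:E)))%E).
    apply: ge0_le_integral => //.
    - by move=> u _; rewrite lee_fin.
    - exact/measurable_EFinP.
    - by apply: emeasurable_funD; [exact/measurable_EFinP|].
    - by move=> u _; rewrite -EFinM -!EFinD lee_fin.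
  rewrite ge0_integralD//; last 3 first.
  - by move=> u _; rewrite lee_fin.
  - exact/measurable_EFinP.
  - by move=> u _; apply: adde_ge0 => //; apply: mule_ge0.
  apply: leeD2l; rewrite ge0_integralD//; last 2 first.
  - by move=> u _; apply: mule_ge0.
  - exact: measurable_funeM.
  rewrite ge0_integralZl// integral_cst_probability /mean_field_error EFinD.
  apply: leeD2l => //; rewrite [leRHS]EFinM; apply: lee_wpmul2l;
    first by rewrite lee_fin.
  exact: weak_law.
have diff u : `|mean_cost u - frozen_cost v u| <=
  e + M * 4 / r ^+ 2 * @dispersion R n U N nubar u.
  rewrite /mean_cost /frozen_cost -mulrBr -sumrB normrM ger0_norm ?invr_ge0//.
  apply: le_trans (ler_wpM2l _ (ler_norm_sum _ _ _)) _;
    first by rewrite invr_ge0.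
  by apply: mean_le => i; exact: cost_difference.
split; apply: aux; do ?[exact: measurable_mean_cost|exact:
  measurable_frozen_cost|
  exact: mean_cost_ge0|exact: frozen_cost_ge0] => u; have := diff u;
  by rewrite ler_norml => /andP[? ?]; lra.
Qed.

End mean_field_limit.

Lemma cst_div_natS_lt (R : realType) (a e : R) : 0 < e ->
  exists N : nat, a / N.+1%:R < e.
Proof.
move=> e0; have [|N] := ltr_add_invr (y := 0) (x := e / (`|a| + 1)).
  by rewrite divr_gt0// ltr_wpDl.
rewrite add0r ltr_pdivlMr ?ltr_wpDl// => Ne.
exists N; apply: le_lt_trans Ne; rewrite mulrC ler_pM2l ?invr_gt0//.
by rewrite (le_trans (ler_norm a))// lerDl.
Qed.

Section mean_cost_limit.
Context (R : realType) (n : nat) (U : nonempty_set 'rV[R]_n).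
Hypothesis compactU : compact (U : set 'rV[R]_n).

Lemma is_average_cst d (T : measurableType d) N (mu : probability T R) :
  is_average mu (fun _ : 'I_N.+1 => mu).
Proof.
move=> A mA; rewrite -(fineK (fin_num_measure mu A mA)) sumEFin -EFinM.
by rewrite sumr_const card_ord -[X in _ * X]mulr_natl mulKf// pnatr_eq0.
Qed.

(* The barycenter is approximated by averages of N points of U thanks to the
   law of large numbers; that it lies in the convex hull is not needed. *)
Lemma near_barycenter (nu : probability (points U) R) (r : R) : 0 < r ->
  exists v : points (conv_hull U),
    forall j, `|set_val v ord0 j - barycenter nu j| < r.
Proof.
move=> r0; have [K K0 UK] := bounded_coord compactU.
have [N NK] : exists N : nat, n%:R * (K *+ 2) ^+ 2 / N.+1%:R < r ^+ 2.
  by apply: cst_div_natS_lt; exact: exprn_gt0.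
(* Otherwise the dispersion would be at least [r ^+ 2] for every sample, against the weak law. *)
apply: contrapT => /forallNP far.
have := weak_law UK (@is_average_cst _ _ N nu).
apply/negP; rewrite -ltNge.
apply: (@lt_le_trans _ _ (r ^+ 2)%:E); first by rewrite lte_fin.
rewrite -[leLHS](integral_cst_probability (product_law (fun _ : 'I_N.+1 =>
  nu))).
apply: ge0_le_integral => //.
- by move=> u _; rewrite lee_fin sqr_ge0.
- by apply/measurable_EFinP; exact: measurable_dispersion.
- move=> u _; rewrite lee_fin.
  have /existsNP[j /negP] := far (average u); rewrite -leNgt => rj.
  rewrite /dispersion (bigD1 j)//= -[leLHS]addr0 lerD//.
    by rewrite -[leRHS]real_normK ?num_real// ler_sqr ?nnegrE// ltW.
  by apply: sumr_ge0 => k _; exact: sqr_ge0.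
Qed.

Variables (phi : points U -> points (conv_hull U) -> R) (M : R).
Hypothesis phi_continuous :
  continuous (fun z : points U * points (conv_hull U) => phi z.1 z.2).
Hypothesis mphi :
  measurable_fun [set: points U * points (conv_hull U)] (fun z => phi z.1 z.2).
Hypothesis phi0 : forall u v, 0 <= phi u v.
Hypothesis phiM : forall u v, phi u v <= M.

Definition expected_mean_cost N (nu : 'I_N.+1 ->
  probability (points U) R) : R :=
  \int[product_law nu]_u (mean_cost phi u).

Lemma EFin_expected_mean_cost N (nu : 'I_N.+1 -> probability (points U) R) :
  (\int[product_law nu]_u (mean_cost phi u)%:E = (expected_mean_cost nu)%:E)%E.
Proof.
apply: (EFin_Rintegral _ (K := M)); first exact: measurable_mean_cost.
by move=> u; rewrite ger0_norm ?mean_cost_ge0// mean_cost_le.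
Qed.

(** Both costs are within [e / 2] of the integral of [phi t v] under [nubar], for a [v] near the
    barycenter. The point [v] varies with [nubar], but the error does not, so [N0] is uniform over
    all laws. *)
Lemma expected_mean_cost_limit (e : R) : 0 < e ->
  exists N0, forall N N', (N0 <= N)%N -> (N0 <= N')%N ->
  forall (nu : 'I_N.+1 -> probability (points U) R)
    (nubar : probability (points U) R),
  is_average nubar (fun i => nu i) ->
  `|expected_mean_cost nu - expected_mean_cost (fun _ : 'I_N'.+1 =>
    nubar)| <= e.
Proof.
move=> e0; have M0 : 0 <= M := le_trans (phi0 point point) (phiM _ _).
have e40 : 0 < e / 4 by rewrite divr_gt0.
have [K K0 UK] := bounded_coord compactU.
have [r r0 rP] : exists2 r : R, 0 < r & forall u (v v' : points (conv_hull U)),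
    (forall j, `|set_val v ord0 j - set_val v' ord0 j| < r) ->
    `|phi u v - phi u v'| < e / 4.
  apply: uniformly_continuous_snd => //; first exact: compact_points.
  by apply: compact_points; exact: compact_convex_hull.
pose D : R := M * 4 / r ^+ 2 * (n%:R * (K *+ 2) ^+ 2).
have D0 : 0 <= D.
  apply: mulr_ge0; last by apply: mulr_ge0 => //; exact: sqr_ge0.
  by apply: divr_ge0; [exact: mulr_ge0|exact: sqr_ge0].
have [N0 N0P] : exists N0, D / N0.+1%:R < e / 4.
  exact: cst_div_natS_lt.
have err N : (N0 <= N)%N -> mean_field_error n M (e / 4) r K N <= e / 2.
  move=> N0N; rewrite /mean_field_error mulrA -/D.
  have -> : e / 2 = e / 4 + e / 4 by field.
  rewrite lerD2l; apply: le_trans (ltW N0P).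
  by rewrite ler_wpM2l// lef_pV2 ?posrE// ler_nat.
exists N0 => N N' N0N N0N' nu nubar avg.
have rP' u (v v' : points (conv_hull U)) :
    (forall j, `|set_val v ord0 j - set_val v' ord0 j| < r) ->
    `|phi u v - phi u v'| <= e / 4.
  by move=> /rP /ltW.
have [v vP] := near_barycenter nubar (divr_gt0 r0 (ltr0n R 2)).
have mphiv : measurable_fun [set: points U] (phi ^~ v).
  exact: (measurableT_comp mphi (pair2_measurable v)).
have phiv : (\int[nubar]_t (phi t v)%:E = (\int[nubar]_t phi t v)%R%:E)%E.
  apply: (EFin_Rintegral _ (K := M)) => // u.
  by rewrite ger0_norm.
have est N1 (nu1 : 'I_N1.+1 -> probability (points U) R) : (N0 <= N1)%N ->
    is_average nubar (fun i => nu1 i) ->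
    `|expected_mean_cost nu1 - \int[nubar]_t phi t v| <= e / 2.
  move=> N01 avg1.
  have [] := mean_cost_estimate mphi phi0 phiM (ltW e40) r0 rP' UK avg1 vP.
  rewrite EFin_expected_mean_cost phiv -!EFinD !lee_fin => h1 h2.
  have := err _ N01 => h3.
  by rewrite ler_norml; apply/andP; split; lra.
have h1 := est _ _ N0N avg.
have h2 := est N' (fun=> nubar) N0N' (is_average_cst _ nubar).
rewrite (splitr e) -(subrKA (\int[nubar]_t phi t v)).
by apply: le_trans (ler_normD _ _) _; rewrite lerD// distrC.
Qed.

End mean_cost_limit.

(** * Costs of profiles *)

Section policy_cost.
Context (R : realType) (dO d0 : measure_display).
Context (Omega : measurableType dO) (Omega0 : measurableType d0).
Context (P : probability Omega R) (w0 : {mfun Omega >-> Omega0}).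
Context (n m : nat) (U : nonempty_set 'rV[R]_n) (Y : nonempty_set 'rV[R]_m).
Context (y : nat -> {mfun Omega >-> points Y}).
Context (Q : probability (points Y) R) (f : points Y -> Omega0 -> R).
Context (c : Omega0 -> points U -> points (conv_hull U) -> R) (M : R).
Hypothesis mf : measurable_fun [set: points Y * Omega0] (fun z => f z.1 z.2).
Hypothesis f0 : forall z x, 0 <= f z x.
Hypothesis fy : product_conditional_law P w0 y
  (fun x B => \int[Q]_(z in B) (f z x)%:E)%E.
Hypothesis mc : measurable_fun [set: Omega0 * points U * points (conv_hull U)]
  (fun x => c x.1.1 x.1.2 x.2).
Hypothesis c0 : forall x u v, 0 <= c x u v.
Hypothesis cM : forall x u v, c x u v <= M.

Let P0 : probability Omega0 R := distribution P w0.

Definition policy_cost N (g : profile U Q 'I_N.+1) : \bar R :=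
  (\int[joint_law P w0 y N.+1]_x team_cost c g x.2 x.1)%E.

Definition action_kernel (g : policy U Q) : R.-pker Omega0 ~> points U :=
  kernel_mix (observation_kernel Q mf f0) (policy_kernel g).

Definition conditional_cost N (g : 'I_N.+1 -> policy U Q) (x : Omega0) : R :=
  expected_mean_cost (c x) (fun i => kernel_at (action_kernel (g i)) x).

Lemma measurable_section x :
  measurable_fun [set: points U * points (conv_hull U)] (fun z => c x z.1 z.2).
Proof.
apply: (@measurableT_comp _ _ _ _ _ _ (fun z => c z.1.1 z.1.2 z.2) _
  (fun z : points U * points (conv_hull U) => (x, z.1, z.2))) => //.
by apply: measurable_fun_pair => //; exact: measurable_fun_pair.
Qed.

Lemma measurable_joint_mean_cost N :
  measurable_fun [set: Omega0 * N.+1.-tuple (points U)]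
    (fun z => (mean_cost (c z.1) z.2)%:E).
Proof.
apply/measurable_EFinP; apply: measurable_funM => //;
  apply: measurable_sum => i.
apply: (@measurableT_comp _ _ _ _ _ _ (fun z => c z.1.1 z.1.2 z.2) _
  (fun z : Omega0 * N.+1.-tuple (points U) =>
    (z.1, tnth z.2 i, average z.2))) => //.
apply: measurable_fun_pair; last first.
  exact: (measurableT_comp (@measurable_average _ _ _ _)).
apply: measurable_fun_pair => //.
exact: (measurableT_comp (measurable_tnth i)).
Qed.

Lemma mean_cost_EFin_ge0 N (z : Omega0 * N.+1.-tuple (points U)) :
  (0 <= (mean_cost (c z.1) z.2)%:E)%E.
Proof. by rewrite lee_fin mean_cost_ge0. Qed.

Lemma EFin_conditional_cost N (g : 'I_N.+1 -> policy U Q) x :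
  (\int[product_law (fun i => kernel_at (action_kernel (g i)) x)]_u
    (mean_cost (c x) u)%:E = (conditional_cost g x)%:E)%E.
Proof.
by apply: (EFin_expected_mean_cost _ (M := M)) => //; exact: measurable_section.
Qed.

Lemma measurable_conditional_cost N (g : 'I_N.+1 -> policy U Q) :
  measurable_fun [set: Omega0] (conditional_cost g).
Proof.
apply/measurable_EFinP; rewrite (_ : _ \o _ = fun x =>
  \int[product_law (fun i => kernel_at (action_kernel (g i)) x)]_u
    (mean_cost (c x) u)%:E)%E.
  exact: (measurable_integral_product_law _ (@mean_cost_EFin_ge0 N)
    (@measurable_joint_mean_cost N)).
by apply/funext => x; rewrite /= EFin_conditional_cost.
Qed.

(** Given omega_0 the observations are integrated out, leaving independent actions with laws
    [action_kernel (g i)]; the cost becomes an average over omega_0 of mean-field costs. *)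
Lemma policy_costE N (g : profile U Q 'I_N.+1) :
  policy_cost g = (\int[P0]_x (conditional_cost g x)%:E)%E.
Proof.
rewrite /policy_cost (integral_joint_law mf f0 fy); last 2 first.
- by move=> z; apply: integral_ge0 => u _; exact: (mean_cost_EFin_ge0 (_, _)).
- rewrite /team_cost.
  apply: (measurable_integral_product_law_tnth _ (p := snd)
    (f := fun z : (Omega0 * N.+1.-tuple (points Y)) * N.+1.-tuple (points U) =>
      (mean_cost (c z.1.1) z.2)%:E)) => //.
    by move=> z; exact: (mean_cost_EFin_ge0 (_, _)).
  apply: (@measurableT_comp _ _ _ _ _ _ (fun z => (mean_cost (c z.1) z.2)%:E) _
    (fun z : (Omega0 * N.+1.-tuple (points Y)) * N.+1.-tuple (points U) =>
      (z.1.1, z.2))); first exact: measurable_joint_mean_cost.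
  apply: measurable_fun_pair => //; exact: measurableT_comp.
apply: eq_integral => x _; rewrite -EFin_conditional_cost.
rewrite -[RHS]integral_product_law_mix//.
- by move=> u; exact: (mean_cost_EFin_ge0 (_, _)).
- by apply/measurable_EFinP; apply: measurable_mean_cost;
    exact: measurable_section.
Qed.

End policy_cost.

(** * Averages of kernels and policies *)

Section average_kernel.
Context d d' (X : measurableType d) (T : measurableType d') (R : realType).
Context (N : nat).

Local Open Scope ereal_scope.

Lemma average_measure_setT (nu : 'I_N.+1 -> {measure set T -> \bar R}) :
  (forall i, nu i [set: T] = 1) -> average_measure nu [set: T] = 1.
Proof.
move=> nu1; rewrite average_measureE//; under eq_bigr do rewrite nu1.
by rewrite sumEFin -EFinM sumr_const card_ord mulVf// pnatr_eq0.
Qed.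

Definition average_probability (nu : 'I_N.+1 -> probability T R) :
  set T -> \bar R := average_measure (fun i => nu i).

HB.instance Definition _ nu := Measure.on (average_probability nu).

Let average_probability_setT nu : average_probability nu [set: T] = 1.
Proof. by apply: average_measure_setT => i; exact: probability_setT. Qed.

HB.instance Definition _ nu := Measure_isProbability.Build _ _ _
  (average_probability nu) (average_probability_setT nu).

Definition average_kernel (k : 'I_N.+1 -> R.-pker X ~> T) (x : X) :
  {measure set T -> \bar R} := average_measure (fun i => k i x).

Variable k : 'I_N.+1 -> R.-pker X ~> T.

Lemma measurable_average_sum (h : 'I_N.+1 -> X -> \bar R) :
  (forall i, measurable_fun [set: X] (h i)) ->
  measurable_fun [set: X] (fun x => (N.+1%:R^-1)%:E * \sum_i h i x).
Proof. by move=> mh; apply: measurable_funeM; exact: emeasurable_sum. Qed.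

Let measurable_average_kernel A :
  measurable A -> measurable_fun [set: X] (average_kernel k ^~ A).
Proof.
move=> mA; rewrite [X in measurable_fun _ X](_ : _ = fun x =>
    (N.+1%:R^-1)%:E * \sum_i k i x A).
  by apply: measurable_average_sum => i; exact: measurable_kernel.
by apply/funext => x; rewrite average_measureE.
Qed.

HB.instance Definition _ :=
  isKernel.Build _ _ _ _ _ (average_kernel k) measurable_average_kernel.

Let average_kernel_prob x : average_kernel k x [set: T] = 1.
Proof. by apply: average_measure_setT => i; exact: prob_kernel. Qed.

HB.instance Definition _ :=
  Kernel_isProbability.Build _ _ _ _ _ (average_kernel k) average_kernel_prob.

Lemma integral_average_sum (mu : {measure set X -> \bar R})
    (h : 'I_N.+1 -> X -> \bar R) D : measurable D ->
  (forall i, measurable_fun [set: X] (h i)) -> (forall i x, 0 <= h i x) ->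
  \int[mu]_(x in D) ((N.+1%:R^-1)%:E * \sum_i h i x) =
  (N.+1%:R^-1)%:E * \sum_i \int[mu]_(x in D) h i x.
Proof.
move=> mD mh h0; rewrite ge0_integralZl//; last 2 first.
- by apply: measurable_funTS; exact: emeasurable_sum.
- by move=> x _; exact: sume_ge0.
by rewrite ge0_integral_sum// => i; exact: measurable_funTS.
Qed.

End average_kernel.

Section average_policy.
Context (R : realType) (n m : nat).
Context (U : nonempty_set 'rV[R]_n) (Y : nonempty_set 'rV[R]_m).
Context (Q : probability (points Y) R).

Local Open Scope ereal_scope.

Lemma measurable_kernel_ysection (k : R.-pker points Y ~> points U)
    (A : set (points U * points Y)) : measurable A ->
  measurable_fun [set: points Y] (fun y => k y (ysection A y)).
Proof.
move=> mA.
have mA' : measurable_fun [set: points Y * points U] (fun z =>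
  (\1_A (z.2, z.1) : R)%:E).
  apply/measurable_EFinP.
  apply: (@measurableT_comp _ _ _ _ _ _ (\1_A : _ -> R) _
    (fun z : points Y * points U => (z.2, z.1))) => //.
  by apply: measurable_fun_pair.
rewrite (_ : (fun y => _) = fun y => \int[k y]_u (\1_A (u, y) : R)%:E).
  exact: (measurable_fun_integral_finite_kernel (fun z =>
    (\1_A (z.2, z.1))%:E) k).
apply/funext => y; have mAy := measurable_ysection y mA.
transitivity (\int[k y]_u (\1_(ysection A y) u : R)%:E).
  by rewrite integral_indic// setIT.
apply: eq_integral => u _.
by congr (_%:E); rewrite !indicE; congr (_%:R); congr nat_of_bool;
  apply/idP/idP; rewrite mem_ysection.
Qed.

(** All policies share the marginal [Q], so the averaged kernel disintegrates the averaged law. The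
    kernel later chosen for this policy may be another version. *)
Lemma average_policy N (g : 'I_N.+1 -> policy U Q) :
  exists gbar : policy U Q, is_average gbar (fun i => g i).
Proof.
pose mu : probability (points U * points Y)%type R :=
  average_probability (fun i => policy_law (g i)).
have muk : exists k, disintegrates Q mu k.
  exists (average_kernel (fun i => policy_kernel (g i))) => A mA.
  rewrite [LHS]average_measureE//.
  transitivity (\int[Q]_y ((N.+1%:R^-1)%:E *
      \sum_i policy_kernel (g i) y (ysection A y))); last first.
    apply: eq_integral => y _; rewrite average_measureE//.
    exact: measurable_ysection.
  rewrite integral_average_sum//.
  - congr (_ * _); apply: eq_bigr => i _.
    exact: (svalP (cid (policy_form (g i)))).
  - by move=> i; exact: measurable_kernel_ysection.
by exists (Policy muk); exact: average_measureE.
Qed.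

Lemma policy_rectangle (g : policy U Q) A E : measurable A -> measurable E ->
  g (A `*` E) = \int[Q]_(y in E) policy_kernel g y A.
Proof.
move=> mA mE; rewrite (svalP (cid (policy_form g)))//; last exact: measurableX.
rewrite [RHS]integral_mkcond; apply: eq_integral => y _; rewrite patchE.
case: ifPn => yE; first by rewrite in_ysectionX.
by rewrite notin_ysectionX//; exact: measure0.
Qed.

(** Over every measurable [E] both functions integrate to the mass that [gbar] gives to the
    rectangle of [A] and [E]. The exceptional null set may depend on [A]. *)
Lemma average_policy_kernel N (g : 'I_N.+1 ->
  policy U Q) (gbar : policy U Q) A :
  is_average gbar (fun i => g i) -> measurable A ->
  ae_eq Q setT (fun y => policy_kernel gbar y A)
    (fun y => (N.+1%:R^-1)%:E * \sum_i policy_kernel (g i) y A).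
Proof.
move=> avg mA.
have mk h : measurable_fun [set: points Y] (fun y => policy_kernel h y A).
  exact: measurable_kernel.
apply: integral_ae_eq => //.
- apply/integrableP; split => //.
  under eq_integral do rewrite gee0_abs//.
  rewrite -policy_rectangle//; apply: le_lt_trans (ltry 1%R).
  by apply: probability_le1; exact: measurableX.
- exact: measurable_average_sum.
move=> E _ mE; rewrite integral_average_sum//.
rewrite -policy_rectangle// avg//; last exact: measurableX.
by congr (_ * _); apply: eq_bigr => i _; rewrite -policy_rectangle.
Qed.

End average_policy.

(** * From fixed omega_0 to expected costs *)

Section mean_field_comparison.
Context (R : realType) (dO d0 : measure_display).
Context (Omega : measurableType dO) (Omega0 : measurableType d0).
Context (P : probability Omega R) (w0 : {mfun Omega >-> Omega0}).
Context (n m : nat) (U : nonempty_set 'rV[R]_n) (Y : nonempty_set 'rV[R]_m).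
Context (y : nat -> {mfun Omega >-> points Y}).
Context (Q : probability (points Y) R) (f : points Y -> Omega0 -> R).
Context (c : Omega0 -> points U -> points (conv_hull U) -> R) (M : R).
Hypothesis mf : measurable_fun [set: points Y * Omega0] (fun z => f z.1 z.2).
Hypothesis f0 : forall z x, 0 <= f z x.
Hypothesis fy : product_conditional_law P w0 y
  (fun x B => \int[Q]_(z in B) (f z x)%:E)%E.
Hypothesis mc : measurable_fun [set: Omega0 * points U * points (conv_hull U)]
  (fun x => c x.1.1 x.1.2 x.2).
Hypothesis c0 : forall x u v, 0 <= c x u v.
Hypothesis cM : forall x u v, c x u v <= M.
Hypothesis compactU : compact (U : set 'rV[R]_n).
Hypothesis c_continuous : forall x,
  continuous (fun uv : points U * points (conv_hull U) => c x uv.1 uv.2).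

Let P0 : probability Omega0 R := distribution P w0.

(** The kernels agree off a [Q]-null set, which the observation kernel also neglects at every [x];
    as [A] is fixed, the dependence of that null set on [A] is harmless. *)
Lemma average_action_kernel N (g : 'I_N.+1 ->
  policy U Q) (gbar : policy U Q) x :
  is_average gbar (fun i => g i) ->
  is_average (kernel_at (action_kernel mf f0 gbar) x)
    (fun i => kernel_at (action_kernel mf f0 (g i)) x).
Proof.
move=> avg A mA; rewrite [LHS]kernel_mixE.
have mk h : measurable_fun [set: points Y] (fun y => policy_kernel h y A).
  exact: measurable_kernel.
rewrite (@ge0_ae_eq_integral _ _ _ _ _ _ (fun y =>
    (N.+1%:R^-1)%:E * \sum_i policy_kernel (g i) y A)%E)//.
- by rewrite integral_average_sum.
- exact: measurable_average_sum.
- by move=> z _; apply: mule_ge0 => //; exact: sume_ge0.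
have [B [mB QB0 AB]] := average_policy_kernel avg mA.
by exists B; split => //; exact: density_kernel_dominated.
Qed.

Lemma conditional_cost_bounds N (g : 'I_N.+1 -> policy U Q) x :
  0 <= conditional_cost c mf f0 g x <= M.
Proof.
have mcx := measurable_section mc x.
rewrite -!lee_fin -(EFin_conditional_cost mf f0 mc c0 cM g).
apply/andP; split.
  by apply: integral_ge0 => u _; exact: (mean_cost_EFin_ge0 c0 (x, u)).
rewrite -[leRHS](integral_cst_probability
  (product_law (fun i => kernel_at (action_kernel mf f0 (g i)) x))).
apply: ge0_le_integral => //.
- by move=> u _; exact: (mean_cost_EFin_ge0 c0 (x, u)).
- by apply/measurable_EFinP; exact: measurable_mean_cost.
- by move=> u _; rewrite lee_fin; apply: mean_cost_le.
Qed.

Lemma policy_cost_bounds N (g : profile U Q 'I_N.+1) :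
  (0 <= policy_cost P w0 y c g <= M%:E)%E.
Proof.
rewrite (policy_costE mf f0 fy mc c0 cM); apply/andP; split.
  apply: integral_ge0 => x _; rewrite lee_fin.
  by have /andP[] := conditional_cost_bounds g x.
rewrite -[leRHS](integral_cst_probability P0).
apply: ge0_le_integral => //.
- by move=> x _; rewrite lee_fin; have /andP[] := conditional_cost_bounds g x.
- by apply/measurable_EFinP; exact: (measurable_conditional_cost mf f0 mc c0
    cM).
- by move=> x _; rewrite lee_fin; have /andP[] := conditional_cost_bounds g x.
Qed.

Lemma policy_cost_fin N (g : profile U Q 'I_N.+1) :
  policy_cost P w0 y c g \is a fin_num.
Proof.
have /andP[J0 JM] := policy_cost_bounds g.
by rewrite ge0_fin_numE// (le_lt_trans JM) ?ltry.
Qed.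

(* Arguing by contradiction, dominated convergence is applied along a sequence
   of profiles, so that no modulus of continuity measurable in x is needed. *)
Lemma policy_cost_comparison (e : R) : 0 < e ->
  exists N0, forall N N', (N0 <= N)%N -> (N0 <= N')%N ->
  forall (g : profile U Q 'I_N.+1) (gbar : policy U Q),
  is_average gbar (fun i => g i) ->
  `|fine (policy_cost P w0 y c g) -
    fine (policy_cost P w0 y c ((fun=> gbar) : profile U Q 'I_N'.+1))| <= e.
Proof.
move=> e0; apply: contrapT => /forallNP far.
pose diff N N' (g : profile U Q 'I_N.+1) (gbar : policy U Q) x : R :=
  `|conditional_cost c mf f0 g x -
    conditional_cost c mf f0 (fun _ : 'I_N'.+1 => gbar) x|.
(* Counterexamples whose two team sizes are both at least [k]; only their difference functions of
   omega_0 enter the dominated convergence. *)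
have /choice[D DP] : forall k, exists Dk : Omega0 -> R,
    exists (N N' : nat) (g : profile U Q 'I_N.+1) (gbar : policy U Q),
    [/\ (k <= N)%N, (k <= N')%N, is_average gbar (fun i => g i),
      Dk = @diff N N' g gbar &
      e < `|fine (policy_cost P w0 y c g) -
            fine (policy_cost P w0 y c ((fun=> gbar) : profile U Q 'I_N'.+1))|].
  move=> k; have := far k.
  move=> /existsNP[N] /existsNP[N'] /not_implyP[kN] /not_implyP[kN'].
  move=> /existsNP[g] /existsNP[gbar] /not_implyP[avg /negP].
  rewrite -ltNge => lt_e.
  by exists (@diff N N' g gbar), N, N', g, gbar.
have mD k : measurable_fun [set: Omega0] (EFin \o D k).
  have [N [N' [g [gbar [_ _ _ -> _]]]]] := DP k.
  apply/measurable_EFinP; apply: measurableT_comp => //.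
  by apply: measurable_funB; exact: (measurable_conditional_cost mf f0 mc c0
    cM).
(* The profiles change with [k], but the threshold for fixed [x] is uniform over profiles, so the
   differences still tend to 0. *)
have D_lim x : (EFin \o D k) x @[k --> \oo] --> 0%E.
  apply: cvg_EFin; first by near=> k.
  apply/cvgrPdist_le => /= r r0.
  have [N0 N0P] := expected_mean_cost_limit compactU (@c_continuous x)
    (measurable_section mc x) (c0 x) (cM x) r0.
  exists N0 => // k /= N0k.
  have [N [N' [g [gbar [kN kN' avg -> _]]]]] := DP k.
  rewrite sub0r normrN normr_id.
  apply: N0P; [exact: leq_trans kN|exact: leq_trans kN'|].
  exact: average_action_kernel.
have D_dom k x : (`|(EFin \o D k) x| <= (cst M%:E) x)%E.
  have [N [N' [g [gbar [_ _ _ -> _]]]]] := DP k.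
  rewrite /= lee_fin normr_id.
  have /andP[? ?] := conditional_cost_bounds g x.
  have /andP[? ?] := conditional_cost_bounds (fun _ : 'I_N'.+1 => gbar) x.
  by rewrite ler_norml; apply/andP; split; lra.
have Mint : P0.-integrable [set: Omega0] (cst M%:E).
  exact: finite_measure_integrable_cst.
have M_fin x : [set: Omega0] x -> cst M%:E x \is a fin_num by [].
have := dominated_cvg measurableT mD (fun x _ => D_lim x) M_fin Mint
  (fun k x _ => D_dom k x).
rewrite integral0 => Dint.
have De k : (e%:E <= \int[P0]_x (D k x)%:E)%E.
  have [N [N' [g [gbar [_ _ _ -> /ltW lt_e]]]]] := DP k; rewrite /diff.
  have mg N1 (h : 'I_N1.+1 -> policy U Q) :
      P0.-integrable [set: Omega0] (EFin \o conditional_cost c mf f0 h).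
    apply: (bounded_integrable P0 (K := M)).
      exact: (measurable_conditional_cost mf f0 mc c0 cM).
    by move=> x; have /andP[? ?] := conditional_cost_bounds h x;
      rewrite ger0_norm.
  apply: le_trans (_ : (`|\int[P0]_x ((conditional_cost c mf f0 g x)%:E -
    (conditional_cost c mf f0 (fun _ : 'I_N'.+1 => gbar) x)%:E)| <= _))%E;
      last first.
    apply: le_trans (le_abse_integral _ measurableT _) _.
      by apply/measurable_EFinP; apply: measurable_funB;
        exact: (measurable_conditional_cost mf f0 mc c0 cM).
    by under eq_integral do rewrite -EFinB abse_EFin.
  rewrite integralB//; last 2 first.
  - exact: mg.
  - exact: mg.
  rewrite -!(policy_costE mf f0 fy mc c0 cM).
  rewrite -(fineK (policy_cost_fin _)) -[X in (_ - X)%E](fineK (policy_cost_fin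
    _)).
  by rewrite -EFinB.
have : (e%:E <= 0)%E.
  rewrite -(cvg_lim _ Dint)//; apply: lime_ge; first by apply/cvg_ex;
    exists 0%E.
  by apply: nearW => k; exact: De.
by rewrite lee_fin leNgt e0.
Unshelve. all: end_near.
Qed.

End mean_field_comparison.

(** * Bounds on expected costs *)

Section lower_integral.
Context d (T : measurableType d) (R : realType).

Local Open Scope ereal_scope.

Import HBNNSimple.

(* The integral of a nonnegative function is a supremum over simple functions
   below it, hence monotone even without measurability. *)
Lemma ge0_le_integral_nonmeasurable (mu : {measure set T ->
  \bar R}) (f g : T -> \bar R) :
  (forall t, 0 <= f t) -> (forall t, f t <= g t) ->
  \int[mu]_t f t <= \int[mu]_t g t.
Proof.
move=> f0 fg; have g0 t : 0 <= g t := le_trans (f0 t) (fg t).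
rewrite ge0_integralTE// ge0_integralTE//; apply: le_ereal_sup.
by move=> _ [h hf <-]; exists h => // t; exact: le_trans (hf t) (fg t).
Qed.

(** Every simple function below [f] integrates to its value at [a], hence to at most [f a]. The
    inequality survives for nonmeasurable [f]. *)
Lemma integral_dirac_le (mu : {measure set T -> \bar R}) (a : T) (f : T ->
  \bar R) :
  (forall A, measurable A -> mu A = \d_a A) -> (forall t, 0 <= f t) ->
  \int[mu]_t f t <= f a.
Proof.
move=> mua f0; rewrite (eq_measure_integral \d_a); last by move=> A mA _;
  exact: mua.
rewrite ge0_integralTE//; apply: ge_ereal_sup => _ [h hf <-].
rewrite -integralT_nnsfun integral_dirac//=; last exact/measurable_EFinP.
by rewrite diracE in_setT mul1e; exact: hf.
Qed.

End lower_integral.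

Section limn_esup_bounds.
Context (R : realType) (u : nat -> \bar R).

Local Open Scope ereal_scope.

Lemma limn_esup_le_near (b : \bar R) N :
  (forall n, (N <= n)%N -> u n <= b) -> limn_esup u <= b.
Proof.
move=> ub; rewrite /limn_esup /limf_esup; apply: ereal_inf_le.
exists (ereal_sup (u @` [set n | (N <= n)%N])) => /=; last first.
  by apply: ge_ereal_sup => _ [n /= Nn <-]; exact: ub.
by exists [set n | (N <= n)%N] => //; exists N.
Qed.

Lemma limn_esup_lt_near (b : \bar R) :
  limn_esup u < b -> exists N, forall n, (N <= n)%N -> u n < b.
Proof.
rewrite /limn_esup /limf_esup => /ereal_inf_lt[_ [A [N _ NA] <-] Ab].
exists N => n Nn; apply: le_lt_trans Ab; apply: ereal_sup_ubound.
by exists n => //; exact: NA.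
Qed.

End limn_esup_bounds.

Section team_bounds.
Context (R : realType) (dO d0 : measure_display).
Context (Omega : measurableType dO) (Omega0 : measurableType d0).
Context (P : probability Omega R) (w0 : {mfun Omega >-> Omega0}).
Context (n m : nat) (U : nonempty_set 'rV[R]_n) (Y : nonempty_set 'rV[R]_m).
Context (y : nat -> {mfun Omega >-> points Y}).
Context (Q : probability (points Y) R) (f : points Y -> Omega0 -> R).
Context (c : Omega0 -> points U -> points (conv_hull U) -> R) (M : R).
Hypothesis mf : measurable_fun [set: points Y * Omega0] (fun z => f z.1 z.2).
Hypothesis f0 : forall z x, 0 <= f z x.
Hypothesis fy : product_conditional_law P w0 y
  (fun x B => \int[Q]_(z in B) (f z x)%:E)%E.
Hypothesis mc : measurable_fun [set: Omega0 * points U * points (conv_hull U)]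
  (fun x => c x.1.1 x.1.2 x.2).
Hypothesis c0 : forall x u v, 0 <= c x u v.
Hypothesis cM : forall x u v, c x u v <= M.
Hypothesis compactU : compact (U : set 'rV[R]_n).
Hypothesis c_continuous : forall x,
  continuous (fun uv : points U * points (conv_hull U) => c x uv.1 uv.2).

Local Open Scope ereal_scope.

Local Notation J := (policy_cost P w0 y c).
Local Notation EJ := (expected_cost P w0 y c).

Definition team_value N : \bar R :=
  ereal_inf [set J g | g in [set: profile U Q 'I_N.+1]].

Lemma policy_cost_ge0 N (g : profile U Q 'I_N.+1) : 0 <= J g.
Proof. by have /andP[] := policy_cost_bounds mf f0 fy mc c0 cM g. Qed.

Lemma policy_cost_le N (g : profile U Q 'I_N.+1) : J g <= M%:E.
Proof. by have /andP[] := policy_cost_bounds mf f0 fy mc c0 cM g. Qed.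

Lemma team_value_le N (g : profile U Q 'I_N.+1) : team_value N <= J g.
Proof. by apply: ereal_inf_lbound; exists g. Qed.

Lemma team_value_ge0 N : 0 <= team_value N.
Proof. by apply: le_ereal_inf_tmp => _ [g _ <-]; exact: policy_cost_ge0. Qed.

Lemma team_value_fin N : team_value N \is a fin_num.
Proof.
rewrite ge0_fin_numE ?team_value_ge0//.
exact: le_lt_trans (le_trans (team_value_le point) (policy_cost_le _)) (ltry M).
Qed.

Lemma expected_cost_ge N (L : probability (profile U Q 'I_N.+1) R) :
  team_value N <= EJ L.
Proof.
rewrite -[leLHS](integral_cst_probability L).
apply: ge0_le_integral_nonmeasurable => g; first exact: team_value_ge0.
exact: team_value_le.
Qed.

Lemma expected_cost_ge0 N (L : probability (profile U Q 'I_N.+1) R) : 0 <= EJ L.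
Proof. exact: le_trans (team_value_ge0 N) (expected_cost_ge L). Qed.

Lemma expected_cost_le N (L : probability (profile U Q 'I_N.+1) R) : EJ L <=
  M%:E.
Proof.
rewrite -[leRHS](integral_cst_probability L).
apply: ge0_le_integral_nonmeasurable => g; first exact: policy_cost_ge0.
exact: policy_cost_le.
Qed.

Lemma expected_cost_fin N (L : probability (profile U Q 'I_N.+1) R) :
  EJ L \is a fin_num.
Proof.
rewrite ge0_fin_numE ?expected_cost_ge0//.
exact: le_lt_trans (expected_cost_le L) (ltry M).
Qed.

Lemma expected_cost_dirac N (L : probability (profile U Q 'I_N.+1) R) g :
  (forall A, measurable A -> L A = \d_g A) -> EJ L <= J g.
Proof. by move=> Lg; apply: (integral_dirac_le Lg) => h;
  exact: policy_cost_ge0. Qed.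

Lemma prod_dirac N (gbar : policy U Q) (A : 'I_N ->
  set (policy U Q)) (b : bool) :
  reflect (forall i, A i gbar) b ->
    b%:R%:E = \prod_(i < N) \d_gbar (A i) :> \bar R.
Proof.
case=> [Ag|/existsNP[i nAg]].
  by rewrite big1// => i _; rewrite diracE mem_set.
by rewrite (bigD1 i)//= diracE memNset// mul0e.
Qed.

Lemma dirac_PRSYM N (gbar : policy U Q) :
  L_PRSYM U Q N (\d_((fun=> gbar) : profile U Q 'I_N)).
Proof.
exists \d_gbar => A mA; rewrite /= diracE.
by apply: prod_dirac; exact: asboolP.
Qed.

Lemma PRSYM_le N (gbar : policy U Q) :
  ereal_inf [set EJ L | L in L_PRSYM U Q N.+1] <=
  J ((fun=> gbar) : profile U Q 'I_N.+1).
Proof.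
apply: (@le_trans _ _ (EJ \d_((fun=> gbar) : profile U Q 'I_N.+1))).
  by apply: ereal_inf_lbound; exists \d_((fun=> gbar) : profile U Q 'I_N.+1) =>
    //; exact: dirac_PRSYM.
exact: expected_cost_dirac.
Qed.

Lemma expected_cost_infty_dirac (gbar : policy U Q) N (b : \bar R) :
  (forall N', (N <= N')%N -> J ((fun=> gbar) : profile U Q 'I_N'.+1) <= b) ->
  expected_cost_infty P w0 y c \d_((fun=> gbar) : profile U Q nat) <= b.
Proof.
move=> Jb; apply: (@limn_esup_le_near _ _ _ N) => N' NN'.
(* The marginal of the Dirac measure at the infinite constant profile is, by computation, the Dirac
   measure at the finite one. *)
by apply: le_trans (Jb _ NN'); exact: expected_cost_dirac.
Qed.

(** Half of [e] pays for a near-optimal profile of the team [N], half for averaging it. The same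
    [gbar] serves every large [N']: taking [N' = N] bounds the symmetric infimum, and letting [N']
    grow bounds the value of the infinite problem. *)
Lemma near_optimal_symmetric (e : R) : (0 < e)%R ->
  exists N0, forall N, (N0 <= N)%N -> exists gbar : policy U Q,
    forall N', (N0 <= N')%N ->
    J ((fun=> gbar) : profile U Q 'I_N'.+1) <= team_value N + e%:E.
Proof.
move=> e0; have e20 : (0 < e / 2)%R by rewrite divr_gt0.
have [N0 N0P] := policy_cost_comparison mf f0 fy mc c0 cM compactU c_continuous
  e20.
exists N0 => N N0N.
have [_ [g _ <-] gV] : exists2 x,
  [set J g | g in [set: profile U Q 'I_N.+1]] x &
    x < team_value N + (e / 2)%:E.
  by apply: ereal_inf_lt; rewrite -/(team_value N) lteDl ?lte_fin//
    team_value_fin.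
have [gbar avg] := average_policy g.
exists gbar => N' N0N'; have := N0P N N' N0N N0N' g gbar avg.
have Jfin N1 (h : profile U Q 'I_N1.+1) : J h \is a fin_num.
  exact: (policy_cost_fin mf f0 fy mc c0 cM).
rewrite ler_norml => /andP[Jg _].
move: gV; rewrite -(fineK (Jfin _ g)) -(fineK (Jfin _ (fun=> gbar))) -(fineK
  (team_value_fin N)).
rewrite -!EFinD lte_fin lee_fin => gV.
lra.
Qed.

Lemma PRSYM_fin N : ereal_inf [set EJ L | L in L_PRSYM U Q N.+1] \is a fin_num.
Proof.
rewrite ge0_fin_numE.
  exact: le_lt_trans (le_trans (@PRSYM_le N point) (policy_cost_le _)) (ltry M).
by apply: le_ereal_inf_tmp => _ [L _ <-]; exact: expected_cost_ge0.
Qed.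

End team_bounds.

Theorem theorem6p1
    (R : realType) (dO d0 : measure_display)
    (Omega : measurableType dO) (Omega0 : measurableType d0)
    (P : probability Omega R) (w0 : {mfun Omega >-> Omega0})
    (n m : nat) (U : nonempty_set 'rV[R]_n) (Y : nonempty_set 'rV[R]_m)
    (y : nat -> {mfun Omega >-> points Y})
    (Q : probability (points Y) R) (f : points Y -> Omega0 -> R)
    (c : Omega0 -> points U -> points (conv_hull U) -> R)
    (borelOmega0 : borel_space R Omega0)
    (borelU : borel_set (U : set 'rV[R]_n))
    (borelY : borel_set (Y : set 'rV[R]_m))
    (y_iid : conditionally_iid P w0 y)
    (y_density : conditional_density P w0 y Q f)
    (c_measurable : measurable_fun [set: Omega0 * points U * points (conv_hull U)]
      (fun x => c x.1.1 x.1.2 x.2))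
    (c_ge0 : forall x u v, 0 <= c x u v)
    (compactU : compact (U : set 'rV[R]_n))
    (c_continuous : forall x,
      continuous (fun uv : points U * points (conv_hull U) => c x uv.1 uv.2))
    (c_bounded : exists M : R, forall x u v, c x u v <= M) :
  exists eps : nat -> R,
    [/\ eps @ \oo --> (0 : R),
        forall N,
          (ereal_inf [set expected_cost P w0 y c L | L in L_PRSYM U Q N.+1] <=
             ereal_inf [set expected_cost P w0 y c L | L in L_CO U Q N.+1]
               + (eps N)%:E)%E /\
          (ereal_inf [set expected_cost P w0 y c L | L in L_PRSYM U Q N.+1] <=
             ereal_inf [set expected_cost P w0 y c L | L in L_D U Q N.+1]
               + (eps N)%:E)%E &
        forall Pstar : probability (profile U Q nat) R,
          L_PRSYM_infty U Q Pstar -> optimal_infty P w0 y c Pstar ->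
          exists epsbar : nat -> R,
            [/\ forall N, 0 <= epsbar N,
                epsbar @ \oo --> (0 : R) &
                forall N,
                  (expected_cost P w0 y c (marginal N.+1 Pstar) <=
                     ereal_inf [set expected_cost P w0 y c L | L in L_D U Q N.+1]
                       + (eps N)%:E + (epsbar N)%:E)%E]].
Proof.
have [M cM] := c_bounded; have [mf f0 fy] := y_density.
pose J N (g : profile U Q 'I_N.+1) := policy_cost P w0 y c g.
pose V N := fine (team_value P w0 y Q c N).
have VE N : team_value P w0 y Q c N = (V N)%:E.
  by rewrite fineK// (team_value_fin mf f0 fy c_measurable c_ge0 cM).
pose S N := ereal_inf [set expected_cost P w0 y c L | L in L_PRSYM U Q N.+1].
have SE N : S N = (fine (S N))%:E.
  by rewrite fineK// (PRSYM_fin mf f0 fy c_measurable c_ge0 cM).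
have near_opt := near_optimal_symmetric mf f0 fy c_measurable c_ge0 cM compactU
  c_continuous.
have S_le N gbar := PRSYM_le mf f0 fy c_measurable c_ge0 cM N gbar.
have V_le N (L : probability (profile U Q 'I_N.+1) R) :=
  expected_cost_ge mf f0 fy c_measurable c_ge0 cM L.
(* The gap to the infimum over profiles, which lies below the cost of every measure; one sequence
   thus serves both inequalities of (i). *)
pose eps N : R := Num.max 0 (fine (S N) - V N).
have eps_ge0 N : 0 <= eps N by rewrite le_max lexx.
have eps_cvg : eps @ \oo --> (0 : R).
  apply/cvgrPdist_le => e e0; have [N0 N0P] := near_opt e e0.
  exists N0 => // N /= N0N; rewrite sub0r normrN ger0_norm//.
  rewrite ge_max (ltW e0)/= lerBlDl -lee_fin EFinD -SE -VE.
  by have [gbar gbarP] := N0P N N0N;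
    exact: le_trans (S_le N gbar) (gbarP N N0N).
have S_eps N (A : set (probability (profile U Q 'I_N.+1) R)) :
    (S N <= ereal_inf [set expected_cost P w0 y c L | L in A] + (eps N)%:E)%E.
  apply: (@le_trans _ _ (team_value P w0 y Q c N + (eps N)%:E)%E).
    by rewrite VE SE -EFinD lee_fin -lerBlDl le_max lexx orbT.
  by apply: leeD2r; apply: le_ereal_inf_tmp => _ [L _ <-]; exact: V_le.
exists eps; split => // [N|Pstar _ Pstar_opt]; first by split; exact: S_eps.
pose a N := expected_cost P w0 y c (marginal N.+1 Pstar).
have aE N : a N = (fine (a N))%:E.
  by rewrite fineK// (expected_cost_fin mf f0 fy c_measurable c_ge0 cM).
have a_ge0 N : (0 <= a N)%E.
  exact: (expected_cost_ge0 mf f0 fy c_measurable c_ge0 cM).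
pose s := expected_cost_infty P w0 y c Pstar.
have s_ge0 : (0 <= s)%E.
  rewrite leNgt; apply/negP => /limn_esup_lt_near[N /(_ N (leqnn N))].
  by apply/negP; rewrite -leNgt; exact: a_ge0.
(* Constant profiles compete in the infinite problem as Dirac measures. The bound holds against each
   large [V N] separately, so no convergence of [V] has to be established. *)
have s_le (e : R) : 0 < e -> exists N0, forall N, (N0 <= N)%N ->
  (s <= (V N + e)%:E)%E.
  move=> e0; have [N0 N0P] := near_opt e e0; exists N0 => N N0N.
  have [gbar gbarP] := N0P N N0N.
  rewrite EFinD -VE /s Pstar_opt.
  apply: le_trans (expected_cost_infty_dirac mf f0 fy c_measurable c_ge0 cM
    gbarP).
  by apply: ereal_inf_lbound; exists (\d_((fun=> gbar) : profile U Q nat)).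
have s_fin : s \is a fin_num.
  have [N0 N0P] := s_le 1 ltr01.
  by rewrite ge0_fin_numE// (le_lt_trans (N0P N0 (leqnn _))) ?ltry.
(* Exactly the excess left over the bound [V N + eps N]; it may be negative, hence the truncation at
   0. *)
pose epsbar N : R := Num.max 0 (fine (a N) - V N - eps N).
exists epsbar; split => [N||N].
- by rewrite le_max lexx.
- apply/cvgrPdist_le => e e0; have e20 : 0 < e / 2 by rewrite divr_gt0.
  have [N0 N0P] := s_le _ e20.
  (* As [s] is the limit superior of [a], eventually [a N < s + e / 2], which is at most
     [V N + e]. *)
  have [|N1 N1P] := @limn_esup_lt_near _ a (s + (e / 2)%:E)%E.
    by rewrite lteDl ?lte_fin.
  exists (maxn N0 N1) => // N /=; rewrite geq_max => /andP[N0N N1N].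
  rewrite sub0r normrN ger0_norm; last by rewrite le_max lexx.
  rewrite ge_max (ltW e0)/=.
  have := N0P N N0N; have := N1P N N1N; have := eps_ge0 N.
  by rewrite aE -(fineK s_fin) -EFinD lte_fin lee_fin; lra.
apply: (@le_trans _ _ (team_value P w0 y Q c N + (eps N)%:E + (epsbar N)%:E)%E).
  rewrite -/(a N) VE aE -!EFinD lee_fin.
  have : fine (a N) - V N - eps N <= epsbar N by rewrite le_max lexx orbT.
  lra.
by do 2 apply: leeD2r; apply: le_ereal_inf_tmp => _ [L _ <-]; exact: V_le.
Qed.
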